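(* Let $D$ be an oriented link diagram with a marked interlacement graph $G=\mathcal{L}(D,C)$, where $C$ is an Euler system of the universe graph of $D$, and suppose $G'$ is an arbitrary marked graph. Then $G'=\mathcal{L}(D,C')$ for some Euler system $C'$ of the universe graph of $D$ if and only if $G'$ can be obtained from $G$ through (a finite sequence of) marked local complementations.
   Context: A marked graph is a finite undirected graph $G$ without multiple edges, in which each vertex may be looped or unlooped, each vertex is either unmarked or carries one of the marks $r,c,cr,u,ur$, together with a number $\phi\ge 0$ of free loops (extra components with no vertices or edges). ''Adjacent'' and ''neighbor'' refer to distinct vertices. Marked local complementation at $v\in V(G)$ replaces $G$ by the graph $G_{cru}^v$ obtained by making exactly these changes. (i) The mark of $v$ changes by unmarked $\leftrightarrow u$, $r\leftrightarrow ur$, $c\leftrightarrow cr$. (ii) The mark of each neighbor of $v$ changes by unmarked $\leftrightarrow r$, $c\leftrightarrow ur$, $u\leftrightarrow cr$. (iii) For any two distinct neighbors $x,y$ of $v$, the adjacency between $x$ and $y$ is toggled. Loops and free loops are not changed. An oriented link diagram $D$ is a finite (nonempty) collection of oriented piecewise smooth closed curves in the plane whose only singularities are finitely many double points, each designated as a classical crossing (with over/under information, hence positive or negative) or a virtual crossing. The universe graph $U$ is the abstract $4$-regular graph (loops and multiple edges allowed) whose vertices are the classical crossings and whose edges are the arcs of $D$ joining classical crossings, passing through virtual crossings; $U$ also has one free loop (a component with no vertices or edges) for each link component having no classical crossing. $c(U)$ is the number of connected components of $U$, free loops included. An Euler system $C$ of $U$ is a set containing one Euler circuit (a closed walk traversing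 every edge exactly once; no preferred orientation or starting point) for each connected component of $U$ that has vertices. Two distinct vertices $v,w$ are interlaced with respect to $C$ if a circuit of $C$ encounters them in the cyclic order $v,w,v,w$. A transition at a vertex $v$ is a partition of the four incident half-edges into two pairs; there are three. With respect to $C$ (orient the incident circuit of $C$ in either way; the choice does not matter) they are: the one following $C$, denoted F; the one other than F that pairs incoming with outgoing half-edges, the orientation-consistent one, denoted N; and the orientation-inconsistent one, denoted I. With respect to $D$, two of the transitions are smoothings: the oriented smoothing (the one consistent with the link orientation that does not follow the strands through the crossing) and the unoriented smoothing (inconsistent with the link orientation). The mark of $v$ determined by $C$ is given by the pair (oriented smoothing, unoriented smoothing): unmarked if it is (N, I); $r$ if (I, N); $c$ if (F, I); $cr$ if (I, F); $u$ if (N, F); $ur$ if (F, N). The marked interlacement graph $\mathcal{L}(D,C)$ has as vertices the classical crossings of $D$, with these marks; a vertex is looped iff the crossing is negative; two distinct vertices are adjacent iff they are interlaced with respect to $C$; and it has $c(U)-1$ free loops. *)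

(* Defs.v *)
From HB Require Import structures.
From mathcomp Require Import all_boot all_order all_algebra finmap.
From mathcomp Require Import all_classical all_reals all_analysis.
From mathcomp Require Import lra.

Set Implicit Arguments.
Unset Strict Implicit.
Unset Printing Implicit Defensive.

Import Order.TTheory GRing.Theory Num.Theory.

Inductive mark := Unmarked | MarkR | MarkC | MarkCR | MarkU | MarkUR.

(* Finite functions and boolean side conditions make Leibniz equality of marked
   graphs extensional.  The vertex set is part of the data. *)
Record marked_graph := MarkedGraph {
  mg_vertex : finType;
  mg_adj : {ffun mg_vertex -> {ffun mg_vertex -> bool}};
  mg_looped : {ffun mg_vertex -> bool};
  mg_mark : {ffun mg_vertex -> mark};
  mg_free_loops : nat;
  mg_adj_sym : [forall x, forall y, mg_adj x y == mg_adj y x];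
  mg_adj_irr : [forall x, ~~ mg_adj x x]
}.

Definition mark_swap_center (m : mark) : mark :=
  match m with
  | Unmarked => MarkU | MarkU => Unmarked
  | MarkR => MarkUR | MarkUR => MarkR
  | MarkC => MarkCR | MarkCR => MarkC
  end.

Definition mark_swap_neighbor (m : mark) : mark :=
  match m with
  | Unmarked => MarkR | MarkR => Unmarked
  | MarkC => MarkUR | MarkUR => MarkC
  | MarkU => MarkCR | MarkCR => MarkU
  end.

Section LocalComplementation.
Variables (G : marked_graph) (v : mg_vertex G).

Definition mlc_adj : {ffun mg_vertex G -> {ffun mg_vertex G -> bool}} :=
  [ffun x => [ffun y =>
    mg_adj G x y (+) [&& x != y, mg_adj G v x & mg_adj G v y]]].

Definition mlc_mark : {ffun mg_vertex G -> mark} :=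
  [ffun x => if x == v then mark_swap_center (mg_mark G x)
             else if mg_adj G v x then mark_swap_neighbor (mg_mark G x)
             else mg_mark G x].

Fact mlc_adj_sym : [forall x, forall y, mlc_adj x y == mlc_adj y x].
Proof.
apply/forallP => x; apply/forallP => y; rewrite !ffunE.
rewrite (eqP (forallP (forallP (mg_adj_sym G) x) y)).
by rewrite [x == y]eq_sym [mg_adj G v x && _]andbC.
Qed.

Fact mlc_adj_irr : [forall x, ~~ mlc_adj x x].
Proof.
apply/forallP => x; rewrite !ffunE eqxx /= addbF.
exact: (forallP (mg_adj_irr G) x).
Qed.

Definition mlc : marked_graph :=
  MarkedGraph (mg_looped G) mlc_mark (mg_free_loops G) mlc_adj_sym mlc_adj_irr.

End LocalComplementation.

Inductive mlc_reachable (G : marked_graph) : marked_graph -> Prop :=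
| mlc_refl : mlc_reachable G G
| mlc_step (H : marked_graph) (v : mg_vertex H) :
    mlc_reachable G H -> mlc_reachable G (mlc v).

(* The edge [e] has the two half-edges [ends e false] and [ends e true]; every
   half-edge belongs to exactly one edge. *)
Record multigraph := Multigraph {
  vertex : finType;
  halfedge : finType;
  edge : finType;
  ends : edge -> bool -> halfedge;
  inc : halfedge -> vertex;
  free_loops : nat;
  ends_bij : bijective (fun eb : edge * bool => ends eb.1 eb.2)
}.

Section Multigraph.
Variable U : multigraph.

Definition joined : rel (vertex U) := fun x y =>
  [exists e : edge U, exists b : bool,
    (inc (ends e b) == x) && (inc (ends e (~~ b)) == y)].

Definition components_number : nat :=
  n_comp joined (vertex U) + free_loops U.

(* An edge together with a direction: [(e, b)] is [e] traversed towards its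
   half-edge [ends e b]. *)
Definition dart := (edge U * bool)%type.
Definition leave (d : dart) : halfedge U := ends d.1 (~~ d.2).
Definition arrive (d : dart) : halfedge U := ends d.1 d.2.

Definition closed_walk (w : seq dart) : bool :=
  cycle (fun d d' => inc (arrive d) == inc (leave d')) w.

(* [w] is an Euler circuit of the component containing [x]. *)
Definition euler_circuit_at (x : vertex U) (w : seq dart) : bool :=
  [&& closed_walk w, uniq [seq d.1 | d <- w]
    & [forall e, (e \in [seq d.1 | d <- w]) ==
                 connect joined x (inc (ends e false))]].

(* Circuits are given with a starting point and a direction, and the circuits
   of a system in some order; nothing defined from a system below depends on
   these choices. *)
Record euler_system := EulerSystem {
  circuits :> seq (seq dart);
  circuitsP : all (fun w => [exists x, euler_circuit_at x w]) circuits;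
  circuits_count : [forall x, count (euler_circuit_at x) circuits == 1%N]
}.

Variable C : euler_system.

Definition cyclic_pattern (w : seq dart) (x y : vertex U) : bool :=
  [exists n : 'I_(size w).+1,
    subseq [:: x; y; x; y] (rot n [seq inc (leave d) | d <- w])].

Definition interlaced (x y : vertex U) : bool :=
  (x != y) && has (fun w => cyclic_pattern w x y) C.

Lemma cyclic_pattern_sym w x y : cyclic_pattern w x y -> cyclic_pattern w y x.
Proof.
rewrite /cyclic_pattern; set s := [seq _ | _ <- w].
have sz : size s = size w by rewrite size_map.
case/existsP => n; set s' := rot n s => xyxy.
have [s1 [s2 [es xs]]] :
    exists s1 s2, s' = s1 ++ x :: s2 /\ subseq [:: y; x; y] s2.
  elim: s' xyxy => [|z s' IH] //=; case: eqP => [<- yxy|_ xyxy].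
    by exists [::], s'.
  by have [s1 [s2 [-> h]]] := IH xyxy; exists (z :: s1), s2.
have hsub : subseq [:: y; x; y; x] (rot (size s1).+1 s').
  rewrite es -cat_rcons -(size_rcons s1 x) rot_size_cat.
  rewrite -[[:: y; x; y; x]]/([:: y; x; y] ++ [:: x]) cat_subseq //.
  by rewrite sub1seq mem_rcons mem_head.
have le1 : ((size s1).+1 <= size w)%N.
  have <- : size s' = size w by rewrite size_rot.
  by rewrite es size_cat /= addnS ltnS leq_addr.
have len : (n <= size w)%N by rewrite -ltnS.
move: hsub; rewrite /s' rot_add_mod ?sz //.
set m := (if _ then _ else _) => hm.
have mlt : (m < (size w).+1)%N.
  by rewrite ltnS /m; case: ifP => // _; rewrite leq_subLR leq_add.
by apply/existsP; exists (Ordinal mlt).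
Qed.

Lemma interlaced_sym x y : interlaced x y = interlaced y x.
Proof.
rewrite /interlaced eq_sym; congr andb; apply: eq_has => w.
by apply/idP/idP; apply: cyclic_pattern_sym.
Qed.

Definition consecutive (d d' : dart) : bool :=
  has (fun w => (d \in w) && (next w d == d')) C.

(* A transition is represented by its set of two blocks. *)
Definition following (x : vertex U) : {set {set halfedge U}} :=
  [set [set arrive p.1; leave p.2] | p : dart * dart
    & consecutive p.1 p.2 && (inc (arrive p.1) == x)].

Definition incoming : {set halfedge U} := [set arrive d | d in flatten C].
Definition outgoing : {set halfedge U} := [set leave d | d in flatten C].

Definition orientation_consistent (P : {set {set halfedge U}}) : bool :=
  [forall B in P, (#|B :&: incoming| == 1%N) && (#|B :&: outgoing| == 1%N)].

End Multigraph.

Inductive transition_type := TransF | TransN | TransI.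

(* Meaningful when [P] is a transition at [x]. *)
Definition type_of_transition (U : multigraph) (C : euler_system U)
    (x : vertex U) (P : {set {set halfedge U}}) : transition_type :=
  if P == following C x then TransF
  else if orientation_consistent C P then TransN else TransI.

(* The types of the oriented and of the unoriented smoothing; these are
   different transitions, so the last case is [(TransN, TransI)]. *)
Definition mark_of_types (o u : transition_type) : mark :=
  match o, u with
  | TransI, TransN => MarkR
  | TransF, TransI => MarkC
  | TransI, TransF => MarkCR
  | TransN, TransF => MarkU
  | TransF, TransN => MarkUR
  | _, _ => Unmarked
  end.

Section PlaneCurves.
Local Open Scope classical_set_scope.
Local Open Scope ring_scope.
Variable R : realType.

Definition smooth (f : R -> R) : Prop :=
  forall n t, derivable (derive1n n f) t 1.

(* On [0, 1], cut at the points of [a], the last of which is 1. *)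
Definition piecewise_smooth (f : R -> R) : Prop :=
  exists a : seq R,
    [/\ path <%O 0 a, last 0 a = 1
      & forall j, (j < size a)%N ->
          exists2 g : R -> R, smooth g
            & forall t, nth 0 (0 :: a) j <= t <= nth 0 a j -> f t = g t].

(* Closed curves are parametrized with period 1, oriented by increasing
   parameter. *)
Definition piecewise_smooth_closed_curve (c : R -> R * R) : Prop :=
  [/\ forall t, c (t + 1) = c t,
      piecewise_smooth (fun t => (c t).1)
    & piecewise_smooth (fun t => (c t).2)].

Section Family.
Variables (I : Type) (c : I -> R -> R * R).

Definition preimages (p : R * R) : set (I * R) :=
  [set s | 0 <= s.2 < 1 /\ c s.1 s.2 = p].

Definition has_velocity (s : I * R) : Prop :=
  derivable (fun t => (c s.1 t).1) s.2 1 /\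
  derivable (fun t => (c s.1 t).2) s.2 1.

Definition velocity (s : I * R) : R * R :=
  (derive1 (fun t => (c s.1 t).1) s.2, derive1 (fun t => (c s.1 t).2) s.2).

Definition det2 (a b : R * R) : R := a.1 * b.2 - a.2 * b.1.

(* Transversality is what makes a double point a crossing with a sign. *)
Definition transverse_double_point (p : R * R) : Prop :=
  exists s s' : I * R,
    [/\ s <> s', preimages p = [set s; s'], has_velocity s, has_velocity s'
      & det2 (velocity s) (velocity s') != 0].

End Family.

(* [over x] and [under x] are the parameters (component, time) of the two
   passages through the classical crossing [x]. *)
Record link_diagram := LinkDiagram {
  ncomp : nat;
  curve : 'I_ncomp.+1 -> R -> R * R;
  classical : {fset R * R};
  virtual : {fset R * R};
  over : classical -> 'I_ncomp.+1 * R;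
  under : classical -> 'I_ncomp.+1 * R;
  curveP : forall i, piecewise_smooth_closed_curve (curve i);
  classical_virtual : [disjoint classical & virtual]%fset;
  crossingP : forall p, p \in (classical `|` virtual)%fset ->
    transverse_double_point curve p;
  noncrossingP : forall p, p \notin (classical `|` virtual)%fset ->
    is_subset1 (preimages curve p);
  overunderP : forall x : classical,
    over x <> under x /\ preimages curve (val x) = [set over x; under x]
}.

Variable D : link_diagram.

Definition crossing : finType := classical D.

Definition negative_crossing (x : crossing) : bool :=
  det2 (velocity (@curve D) (over x)) (velocity (@curve D) (under x)) < 0.

(* [(x, true)] is the overpass at [x] and [(x, false)] the underpass. *)
Definition passage : finType := (crossing * bool)%type.

Definition param (p : passage) : 'I_(ncomp D).+1 * R :=
  if p.2 then over p.1 else under p.1.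

(* The time in ]0, 1] needed to go from the time t to the time t'. *)
Definition delay (t t' : R) : R := if t < t' then t' - t else t' - t + 1.

Definition next_passage (p : passage) : passage :=
  [arg min_(q < p | (param q).1 == (param p).1)
     delay (param p).2 (param q).2]%O.

Lemma param_preimages (p : passage) : preimages (@curve D) (val p.1) (param p).
Proof.
have [_ ->] := overunderP p.1; rewrite /param; case: p.2; by [left|right].
Qed.

Lemma param_inj : injective param.
Proof.
move=> p q pq; have [_ cp] := param_preimages p.
have [_] := param_preimages q; rewrite -pq cp => /val_inj.
case: p q pq {cp} => [x b] [y b'] /= pq xy; subst y.
by have [+ _] := overunderP x; case: b b' pq => [] [] //=; rewrite /param /=
   => e ne; have := ne; rewrite ?e //; case: e.
Qed.

Lemma next_passage_inj : injective next_passage.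
Proof.
move=> p q; rewrite /next_passage.
case: arg_minP => //= r /eqP rp minp; case: arg_minP => //= s /eqP sq minq rs.
subst s; apply: param_inj; apply/eqP; apply: contraT => pq.
have comps : (param q).1 = (param p).1 by rewrite -rp.
have {pq} neq : (param p).2 != (param q).2.
  apply: contra pq => /eqP e.
  by rewrite [param p]surjective_pairing [param q]surjective_pairing comps e.
have := minp q; rewrite comps eqxx => /(_ isT).
have := minq p; rewrite -comps eqxx => /(_ isT).
have [/andP[p0 p1] _] := param_preimages p.
have [/andP[q0 q1] _] := param_preimages q.
have [/andP[r0 r1] _] := param_preimages r.
move: neq p0 p1 q0 q1 r0 r1; move: (param p).2 (param q).2 (param r).2.
move=> {rp sq comps minp minq} a b c; rewrite /delay neq_lt.
by case: (ltP a b); case: (ltP b a); case: (ltP a c); case: (ltP b c) => //= *; lra.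
Qed.

End PlaneCurves.

Section Interlacement.
Variables (R : realType) (D : link_diagram R).

(* The half-edges at the passage [p] are [(p, true)], by which the link
   component leaves the crossing, and [(p, false)], by which it enters it.  The
   arc that leaves [p] is the edge named [p]. *)
Definition universe_ends (p : passage D) (b : bool) : passage D * bool :=
  if b then (next_passage p, false) else (p, true).

Fact universe_ends_bij :
  bijective (fun eb : passage D * bool => universe_ends eb.1 eb.2).
Proof.
apply: injF_bij => -[p []] [q []] //= [] //.
- by move/next_passage_inj ->.
- by move->.
Qed.

Definition universe : multigraph :=
  @Multigraph (crossing D) (passage D * bool)%type (passage D) universe_ends
    (fun h => h.1.1)
    #|[pred i : 'I_(ncomp D).+1 | [forall p : passage D, (param p).1 != i]]|
    universe_ends_bij.

Definition oriented_smoothing (x : vertex universe) :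
    {set {set halfedge universe}} :=
  [set [set ((x, b), false); ((x, ~~ b), true)] | b : bool].

Definition unoriented_smoothing (x : vertex universe) :
    {set {set halfedge universe}} :=
  [set [set ((x, true), o); ((x, false), o)] | o : bool].

Variable C : euler_system universe.

Definition interlacement_adj :
    {ffun vertex universe -> {ffun vertex universe -> bool}} :=
  [ffun x => [ffun y => interlaced C x y]].

Definition interlacement_looped : {ffun vertex universe -> bool} :=
  [ffun x : vertex universe => negative_crossing x].

Definition interlacement_mark : {ffun vertex universe -> mark} :=
  [ffun x => mark_of_types (type_of_transition C x (oriented_smoothing x))
                           (type_of_transition C x (unoriented_smoothing x))].

Fact interlacement_adj_sym :
  [forall x, forall y, interlacement_adj x y == interlacement_adj y x].
Proof.
by apply/forallP => x; apply/forallP => y; rewrite !ffunE interlaced_sym.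
Qed.

Fact interlacement_adj_irr : [forall x, ~~ interlacement_adj x x].
Proof. by apply/forallP => x; rewrite !ffunE /interlaced eqxx. Qed.

(* The subtraction is not truncated: a diagram has at least one component. *)
Definition marked_interlacement_graph : marked_graph :=
  MarkedGraph interlacement_looped interlacement_mark
    (components_number universe - 1)
    interlacement_adj_sym interlacement_adj_irr.

End Interlacement.

(* Main.v *)
(** A circuit through a crossing [v] is a cyclic concatenation of two closed walks
    A B starting at [v], and [v] is interlaced with [x] iff [x] occurs once in A
    and once in B.  Replacing B by its reverse (the kappa-transformation at [v])
    gives another Euler system.  It toggles the interlacement of two vertices iff
    both are interlaced with [v]; it turns over one of the two passages through
    each neighbour of [v], which exchanges the types N and I there, and it
    exchanges F and I at [v].  This is marked local complementation.

    Conversely (Kotzig), let C and C' be Euler systems that differ, and compare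
    the transitions of C' with C.  If C' has type I at some [v], switching C at [v]
    creates one more agreement.  Otherwise C' has type N at some [v].  If it had
    type F at all neighbours of [v], the half-edges of A would be closed under the
    transitions of C', although C' traverses the component in a single circuit.
    Hence C' has type N at some neighbour [w] of [v], and switching at [v], [w],
    [v] creates two more agreements.  Finally, an Euler system is determined by
    its transitions up to rotating and reversing its circuits. *)

Require Import Defs.
From mathcomp Require Import all_boot all_classical all_reals.
(* Imported again: [all_classical] shadows some of their names. *)
From mathcomp Require Import seq finset.

Set Implicit Arguments.
Unset Strict Implicit.
Unset Printing Implicit Defensive.

(** * Alternation in words *)

Section Words.
Variable T : eqType.
Implicit Types (x y z : T) (s t : seq T) (m n : bitseq).

(** The two linear readings of the cyclic word in which two letters, occurring twice each,
    alternate. *)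
Definition alternating m : bool :=
  m \in [:: [:: true; false; true; false]; [:: false; true; false; true]].

Lemma alternating_rot k m : alternating (rot k m) = alternating m.
Proof.
have imp j n : alternating n -> alternating (rot j n).
  rewrite /alternating !inE => /orP[] /eqP ->;
    by case: j => [|[|[|[|j]]]] //; rewrite rot_oversize.
apply/idP/idP; last exact: imp.
by move/(imp (size (rot k m) - k)); rewrite -/(rotr k (rot k m)) rotK.
Qed.

Lemma alternating_rev m : alternating (rev m) = alternating m.
Proof.
have imp n : alternating n -> alternating (rev n).
  by rewrite /alternating !inE => /orP[] /eqP ->.
by apply/idP/idP => /imp //; rewrite revK.
Qed.

(** A check of all words of four bits. If each letter occurs once in [m], then [n] consists of two
    different letters and reversing it exchanges them; in the other cases reversing [n] does not
    affect alternation. *)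
Lemma alternating_cat_rev m n :
  count id (m ++ n) = 2 -> count negb (m ++ n) = 2 ->
  alternating (m ++ rev n) =
    alternating (m ++ n) (+) (odd (count id m) && odd (count negb m)).
Proof.
move=> c1 c2; have sz : size (m ++ n) = 4 by rewrite -(count_predC id) c1 c2.
move: sz c1 c2; case: m => [|a [|b [|c [|d [|e m]]]]];
  case: n => [|a' [|b' [|c' [|d' [|e' n]]]]] //= _;
  by repeat match goal with x : bool |- _ => case: x end.
Qed.

(** Alternation of [x] and [y] depends on this word only. It has four bits when both letters occur
    twice, which reduces claims about circuits to finite checks. *)
Definition trace x y s : bitseq := [seq z == x | z <- s & (z == x) || (z == y)].

Lemma trace_cat x y s t : trace x y (s ++ t) = trace x y s ++ trace x y t.
Proof. by rewrite /trace filter_cat map_cat. Qed.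

Lemma trace_rev x y s : trace x y (rev s) = rev (trace x y s).
Proof. by rewrite /trace filter_rev map_rev. Qed.

Lemma trace_rot x y k s : exists j, trace x y (rot k s) = rot j (trace x y s).
Proof.
exists (size (trace x y (take k s))).
by rewrite -{3}(cat_take_drop k s) trace_cat rot_size_cat -trace_cat.
Qed.

Lemma count_trace x y s : count id (trace x y s) = count_mem x s.
Proof.
rewrite /trace count_map count_filter; apply: eq_count => z /=.
by case: (z == x).
Qed.

Lemma count_negb_trace x y s : x != y ->
  count negb (trace x y s) = count_mem y s.
Proof.
move=> xy; rewrite /trace count_map count_filter; apply: eq_count => z /=.
by case: (eqVneq z x) => //= ->; rewrite (negPf xy).
Qed.

Lemma size_trace x y s : x != y ->
  size (trace x y s) = count_mem x s + count_mem y s.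
Proof.
by move=> xy; rewrite -(count_predC id) count_trace -(count_negb_trace s xy).
Qed.

Definition alternate x y s : bool := alternating (trace x y s).

Lemma alternate_rot x y k s : alternate x y (rot k s) = alternate x y s.
Proof. by rewrite /alternate; have [j ->] := trace_rot x y k s;
  rewrite alternating_rot. Qed.

Lemma alternate_rev x y s : alternate x y (rev s) = alternate x y s.
Proof. by rewrite /alternate trace_rev alternating_rev. Qed.

Lemma alternate_cat_rev x y s t : x != y ->
  count_mem x (s ++ t) = 2 -> count_mem y (s ++ t) = 2 ->
  alternate x y (s ++ rev t) =
    alternate x y (s ++ t) (+) (odd (count_mem x s) && odd (count_mem y s)).
Proof.
move=> xy cx cy; rewrite /alternate !trace_cat trace_rev alternating_cat_rev
  -?trace_cat.
- by rewrite count_trace count_negb_trace.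
- by rewrite count_trace.
- by rewrite count_negb_trace.
Qed.

Lemma trace_nseq x y s :
  x \notin s -> trace x y s = nseq (count_mem y s) false.
Proof.
elim: s => //= z s IH; rewrite inE negb_or eq_sym => /andP[/negPf zx /IH].
rewrite /trace /= zx /=; case: (z == y) => //= ->.
by rewrite zx.
Qed.

(** The two letters [x] cut the cyclic word into [s] and [t], and [y] alternates with [x] when each
    part holds one of its two occurrences. *)
Lemma alternate_split x y s t : x != y -> x \notin s -> x \notin t ->
  count_mem y (s ++ t) = 2 ->
  alternate x y (s ++ x :: t ++ [:: x]) = odd (count_mem y s).
Proof.
move=> xy xs xt; rewrite /alternate -[x :: t ++ _]/([:: x] ++ (t ++ [:: x]))
  !trace_cat.
rewrite (trace_nseq _ xs) (trace_nseq _ xt) count_cat /trace /= eqxx /=.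
by case: (count_mem y s) => [|[|[|j]]]; case: (count_mem y t) => [|[|[|k]]];
  rewrite ?(addSn, addnS) ?eqxx.
Qed.

(** The bounds leave at most four letters in the filtered word, so a subsequence of it with four
    letters is all of it. *)
Lemma trace_subseq x y s : x != y ->
  count_mem x s <= 2 -> count_mem y s <= 2 -> subseq [:: x; y; x; y] s ->
  trace x y s = [:: true; false; true; false].
Proof.
move=> xy cx cy sub; have yx : (y == x) = false by rewrite eq_sym (negPf xy).
have : subseq [:: x; y; x; y] [seq z <- s | (z == x) || (z == y)].
  by rewrite subseq_filter sub /= !eqxx !orbT.
rewrite /trace => /size_subseq_leqif/leqifP; case: eqP => [<- _|_].
  by rewrite /= !eqxx yx.
have := size_trace s xy; rewrite /trace size_map => -> /=.
by rewrite ltnNge (leq_add cx cy).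
Qed.

Lemma alternate_subseq x y s : alternate x y s ->
  subseq [:: x; y; x; y] s \/ subseq [:: y; x; y; x] s.
Proof.
(* Decoding the bits recovers the filtered word, which is a subsequence. *)
have wK t : [seq if b then x else y | b <- trace x y t] =
    [seq z <- t | (z == x) || (z == y)].
  rewrite /trace -map_comp -[RHS]map_id; apply/eq_in_map => z.
  by rewrite mem_filter /= => /andP[+ _]; case: eqP => [->|_ /= /eqP].
by rewrite /alternate /alternating !inE => /orP[] /eqP e;
  [left | right]; move: (filter_subseq (fun z => (z == x) || (z == y)) s);
  rewrite -wK e.
Qed.
End Words.

(** * Consecutive pairs along paths and cycles *)

Section Links.
Variable T : eqType.
Implicit Types (x : T) (s t : seq T).

Definition swap (S : Type) (p : S * S) : S * S := (p.2, p.1).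

Definition links x s : seq (T * T) := zip (belast x s) s.

(** A list of pairs rather than the function [next]: it does not require distinct letters, and
    rotating the cycle just rotates it. *)
Definition turns s : seq (T * T) := zip s (rot 1 s).

Lemma links_cat x s t : links x (s ++ t) = links x s ++ links (last x s) t.
Proof. by rewrite /links belast_cat zip_cat ?size_belast. Qed.

Lemma turns_cons x s : turns (x :: s) = rcons (links x s) (last x s, x).
Proof.
rewrite /turns rot1_cons -{1}(belast_rcons x s x) -/(links x (rcons s x)).
by rewrite -!cats1 links_cat.
Qed.

Lemma unzip1_turns s : unzip1 (turns s) = s.
Proof. by rewrite unzip1_zip // size_rot. Qed.

Lemma unzip2_turns s : unzip2 (turns s) = rot 1 s.
Proof. by rewrite unzip2_zip // size_rot. Qed.

Lemma path_links (e : rel T) x s : path e x s = all (fun p =>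
  e p.1 p.2) (links x s).
Proof. by elim: s x => //= y s IH x; rewrite IH. Qed.

Lemma cycle_turns (e : rel T) s : cycle e s = all (fun p =>
  e p.1 p.2) (turns s).
Proof.
case: s => // x s; rewrite turns_cons /cycle rcons_path path_links all_rcons.
by rewrite andbC.
Qed.

Lemma turns_next s : uniq s -> turns s = [seq (x, next s x) | x <- s].
Proof.
move=> us; suff e : rot 1 s = [seq next s x | x <- s].
  by rewrite /turns e; elim: s {us e} (next s) => //= x s IH f; rewrite IH.
case: s us => // x s us; apply: (@eq_from_nth _ x);
  first by rewrite size_rot size_map.
move=> i; rewrite size_rot => lti; rewrite (nth_map x) // next_nth mem_nth //.
by rewrite index_uniq // rot1_cons nth_rcons; case: ltngtP => // [h|->];
  rewrite ?nth_default // ltnW.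
Qed.

Lemma mem_turns s x y : uniq s ->
  ((x, y) \in turns s) = (x \in s) && (next s x == y).
Proof.
move=> us; rewrite turns_next //;
  apply/mapP/andP => [[z zs [-> ->]] | [xs /eqP <-]].
  by rewrite zs eqxx.
by exists x.
Qed.

Lemma turns_rot k s : turns (rot k s) = rot k (turns s).
Proof.
rewrite /turns rot_rot; move: (rot 1 s) (size_rot 1 s) => t st.
have [lek|ltk] := leqP k (size s); last first.
  by rewrite !rot_oversize ?size_zip ?st ?minnn // ltnW.
have ss : size (take k s) = k by rewrite size_takel.
have tt : size (take k t) = k by rewrite size_takel ?st.
have dd : size (drop k s) = size (drop k t) by rewrite !size_drop st.
rewrite /rot -[in RHS](cat_take_drop k s) -[in RHS](cat_take_drop k t).
move: ss tt dd.
move: (take k s) (drop k s) (take k t) (drop k t) => s1 s2 t1 t2 e1 e2 e.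
rewrite !zip_cat ?e1 // drop_size_cat ?take_size_cat //;
by rewrite size_zip e1 e2 minnn.
Qed.

Lemma map_swap_zip (S : Type) (s t : seq S) : size s = size t ->
  [seq swap p | p <- zip s t] = zip t s.
Proof. by elim: s t => [|x s IH] [|y t] //= [/IH ->]. Qed.

Lemma links_rev x s :
  links (last x s) (rev (belast x s)) = rev [seq swap p | p <- links x s].
Proof.
have eb : belast (last x s) (rev (belast x s)) = rev s.
  have := lastI (last x s) (rev (belast x s)).
  by rewrite -rev_rcons -lastI rev_cons => /rcons_inj[].
by rewrite /links eb map_swap_zip ?size_belast // rev_zip ?size_belast.
Qed.

(** Only a permutation: the pairs inside the path come in reverse order, while the pair that closes
    the cycle stays last. *)
Lemma turns_rev s : perm_eq (turns (rev s)) [seq swap p | p <- turns s].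
Proof.
case: s => // x s; rewrite [in rev _]lastI rev_rcons !turns_cons links_rev.
rewrite map_rcons -!cats1 perm_cat ?perm_rev //.
by case: s => //= y s; rewrite rev_cons last_rcons.
Qed.

End Links.

Lemma links_map (T S : eqType) (f : T -> S) x s :
  links (f x) (map f s) = [seq (f p.1, f p.2) | p <- links x s].
Proof. by elim: s x => //= y s IH x; rewrite -IH. Qed.

Lemma turns_map (T S : eqType) (f : T -> S) s :
  turns (map f s) = [seq (f p.1, f p.2) | p <- turns s].
Proof. by case: s => // x s;
  rewrite /= !turns_cons links_map last_map map_rcons. Qed.

(** * Pairings of four elements *)

Section Pairing.
Variable T : finType.
Implicit Types a b c d : T.

Definition pairing a b c d : {set {set T}} := [set [set a; b]; [set c; d]].

Lemma pairing_swapl a b c d : pairing a b c d = pairing b a c d.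
Proof. by rewrite /pairing (setUC [set a]). Qed.

Lemma pairing_swapr a b c d : pairing a b c d = pairing a b d c.
Proof. by rewrite /pairing (setUC [set c]). Qed.

Lemma pairingC a b c d : pairing a b c d = pairing c d a b.
Proof. by rewrite /pairing setUC. Qed.

(** The block of [a] and [b] equals neither block on the right: the first misses [b] and the second
    misses [a]. *)
Lemma pairing_neq a b c d b' c' d' :
  b \notin [set a; b'] -> a \notin [set c'; d'] ->
  pairing a b c d != pairing a b' c' d'.
Proof.
move=> bN aN; apply/eqP => e.
have : [set a; b] \in pairing a b' c' d' by rewrite -e !inE eqxx.
rewrite !inE => /orP[] /eqP f; [move: bN | move: aN];
by rewrite -f !inE eqxx ?orbT.
Qed.

(** The partner of [i] determines the pairing. The proof runs through the bijections between the two
    quadruples. *)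
Lemma pairing_trichotomy a b c d i o j k : uniq [:: a; b; c; d] ->
  {subset [:: a; b; c; d] <= [:: i; o; j; k]} ->
  [\/ pairing a b c d = pairing i o j k, pairing a b c d = pairing i k o j
    | pairing a b c d = pairing i j o k].
Proof.
move=> u sub; have := sub d; have := sub c; have := sub b; have := sub a.
rewrite !inE !eqxx ?orbT => /(_ isT) ha /(_ isT) hb /(_ isT) hc /(_ isT) hd.
move: u; rewrite /= !inE !negb_or => /and4P[/and3P[ab ac ad] /andP[bc bd] cd _].
have E := (pairing_swapl, pairing_swapr, pairingC).
case/or4P: ha => /eqP ea; case/or4P: hb => /eqP eb;
  try (by rewrite ea eb eqxx in ab);
case/or4P: hc => /eqP ec;
  try (by rewrite ea ec eqxx in ac); try (by rewrite eb ec eqxx in bc);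
case/or4P: hd => /eqP ed;
  try (by rewrite ea ed eqxx in ad); try (by rewrite eb ed eqxx in bd);
  try (by rewrite ec ed eqxx in cd);
rewrite ea eb ec ed {E}.
(* [fin] tries the eight symmetries of a pairing. *)
all: let rec fin := first [ by [] | by rewrite pairing_swapl | by rewrite
  pairing_swapr
  | by rewrite pairing_swapl pairing_swapr
  | by rewrite pairingC | by rewrite pairingC pairing_swapl | by rewrite
    pairingC pairing_swapr
  | by rewrite pairingC pairing_swapl pairing_swapr] in
  first [by constructor 1; fin | by constructor 2; fin | by constructor 3; fin].
Qed.

End Pairing.

(** * Circuits and their passages *)

(** Half-edges are counted, so that a loop contributes twice. *)
Definition four_regular (U : multigraph) : Prop :=
  forall x : vertex U, #|[set h | inc h == x]| = 4.

Section Darts.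
Variable U : multigraph.
Local Notation linked := (connect (joined (U := U))).
Implicit Types (x y : vertex U) (d : dart U) (w : seq (dart U)).
Implicit Types h : halfedge U.

Lemma ends_inj (e e' : edge U) b b' : ends e b = ends e' b' -> e = e' /\ b = b'.
Proof. by move=> h; have [] : (e, b) = (e',
  b') by exact: (bij_inj (ends_bij U)). Qed.

Lemma endsP h : exists e b, h = ends e b.
Proof. by have [g _ gK] := ends_bij U; exists (g h).1, (g h).2; rewrite gK. Qed.

Lemma arrive_inj : injective (@arrive U).
Proof. by move=> [e b] [e' b'] /ends_inj[/= -> ->]. Qed.

Lemma leave_inj : injective (@leave U).
Proof. by move=> [e b] [e' b'] /ends_inj[/= -> /negb_inj ->]. Qed.

Definition flip d : dart U := (d.1, ~~ d.2).

Lemma flipK : involutive flip.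
Proof. by case=> e b; rewrite /flip negbK. Qed.

Lemma arrive_flip d : arrive (flip d) = leave d.
Proof. by []. Qed.

Lemma leave_flip d : leave (flip d) = arrive d.
Proof. by rewrite /leave negbK. Qed.

Lemma joined_sym : symmetric (joined (U := U)).
Proof.
move=> x y; apply/idP/idP => /existsP[e /existsP[b /andP[hx hy]]];
by apply/existsP; exists e; apply/existsP; exists (~~ b); rewrite negbK hx hy.
Qed.

Lemma connect_joined_sym : connect_sym (joined (U := U)).
Proof. exact: sym_connect_sym joined_sym. Qed.

Lemma connect_ends (e : edge U) b b' :
  linked (inc (ends e b)) (inc (ends e b')).
Proof.
have [->|] := eqVneq b' b; first exact: connect0.
rewrite negb_eqb => nb; apply: connect1; apply/existsP; exists e.
have -> : b' = ~~ b by case: b b' nb => [] [].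
by apply/existsP; exists b; rewrite !eqxx.
Qed.

Lemma connect_joined_ends x (e : edge U) b b' :
  linked x (inc (ends e b)) =
  linked x (inc (ends e b')).
Proof. exact: (same_connect_r (@connect_joined_sym) (connect_ends e b b') x).
  Qed.

(** Half-edges are recorded instead of darts, so that traversing the walk backwards merely swaps the
    two components of each passage. *)
Definition passages w : seq (halfedge U * halfedge U) :=
  [seq (arrive p.1, leave p.2) | p <- turns w].

Definition passages_at x w := [seq p <- passages w | inc p.1 == x].

Lemma closed_walkE w : closed_walk w = all (fun p =>
  inc p.1 == inc p.2) (passages w).
Proof. by rewrite /closed_walk cycle_turns all_map. Qed.

Lemma unzip1_passages w : unzip1 (passages w) = [seq arrive d | d <- w].
Proof. by rewrite -[in RHS](unzip1_turns w) /passages /unzip1 -!map_comp. Qed.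

Lemma unzip2_passages w : unzip2 (passages w) = rot 1 [seq leave d | d <- w].
Proof. by rewrite -map_rot -unzip2_turns /passages /unzip2 -!map_comp. Qed.

Lemma passages_rot k w : passages (rot k w) = rot k (passages w).
Proof. by rewrite /passages turns_rot map_rot. Qed.

Definition reverse w : seq (dart U) := rev [seq flip d | d <- w].

Lemma passages_reverse w :
  perm_eq (passages (reverse w)) [seq swap p | p <- passages w].
Proof.
have -> : [seq swap p | p <- passages w] =
    [seq (arrive p.1, leave p.2) | p <- [seq swap p | p <- turns [seq flip d |
      d <- w]]].
  by rewrite turns_map -!map_comp; apply: eq_map => p; rewrite /= leave_flip.
exact: perm_map (turns_rev _).
Qed.

Definition halfedges_of w := unzip1 (passages w) ++ unzip2 (passages w).

Lemma mem_halfedges_of w e b : (ends e b \in halfedges_of w) = (e \in [seq d.1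
  | d <- w]).
Proof.
rewrite /halfedges_of unzip1_passages unzip2_passages mem_cat mem_rot.
apply/orP/mapP => [[] /mapP[d dw /ends_inj[ed _]] | [d dw ed]];
  [by exists d | by exists d | ].
case: (eqVneq d.2 b) => [eb|]; [left | rewrite negb_eqb => nb; right];
  apply/mapP; exists d => //.
  by rewrite /arrive -ed eb.
by rewrite /leave -ed; congr ends; case: (d.2) b nb => [] [].
Qed.

(** A half-edge used both for arriving and for leaving would belong to one edge, hence to one dart,
    whose two ends are different. *)
Lemma uniq_halfedges_of w : uniq [seq d.1 | d <- w] -> uniq (halfedges_of w).
Proof.
move=> u; have uw := map_uniq u.
rewrite /halfedges_of unzip1_passages unzip2_passages cat_uniq rot_uniq.
rewrite (map_inj_uniq arrive_inj) (map_inj_uniq leave_inj) uw andbT /=.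
apply/hasPn => h; rewrite mem_rot => /mapP[d dw ->].
apply/mapP => -[d' d'w /ends_inj[e1 e2]].
have dd : d = d'.
  by apply/eqP; rewrite -(nth_index d dw) -(nth_index d d'w) nth_uniq
    ?index_mem //;
     rewrite -(nth_uniq d.1 _ _ u) ?size_map ?index_mem // !(nth_map d)
       ?index_mem // !nth_index // e1.
by move: e2; rewrite dd; case: (d'.2).
Qed.

End Darts.

Section Circuits.
Variable U : multigraph.
Hypothesis reg : four_regular U.
Local Notation linked := (connect (joined (U := U))).
Implicit Types (x y v : vertex U) (d : dart U) (w : seq (dart U)).
Implicit Types h : halfedge U.

Lemma euler_connect x y w :
  linked x y -> euler_circuit_at x w = euler_circuit_at y w.
Proof.
move=> xy; rewrite /euler_circuit_at; do 2 congr andb; apply: eq_forallb => e.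
by rewrite (same_connect (@connect_joined_sym U) xy).
Qed.

Lemma euler_uniq x w : euler_circuit_at x w -> uniq [seq d.1 | d <- w].
Proof. by case/and3P. Qed.

Lemma euler_closed x w : euler_circuit_at x w -> closed_walk w.
Proof. by case/and3P. Qed.

Lemma euler_mem_halfedge x w h : euler_circuit_at x w ->
  (h \in halfedges_of w) = linked x (inc h).
Proof.
case/and3P => _ _ /forallP H; have [e [b ->]] := endsP h.
by rewrite mem_halfedges_of (eqP (H e)) (connect_joined_ends _ _ _ b).
Qed.

Lemma euler_mem_edge x w e b : euler_circuit_at x w ->
  (e \in [seq d.1 | d <- w]) = linked x (inc (ends e b)).
Proof. by move=> ew; rewrite -(euler_mem_halfedge _ ew) mem_halfedges_of. Qed.

Lemma euler_inc x w p : euler_circuit_at x w -> p \in passages w ->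
  inc p.1 = inc p.2.
Proof. by move/euler_closed; rewrite closed_walkE => /allP/[apply]/eqP. Qed.

Lemma halfedges_at x w : closed_walk w ->
  [seq h <- halfedges_of w | inc h == x] =
  unzip1 (passages_at x w) ++ unzip2 (passages_at x w).
Proof.
rewrite closed_walkE /halfedges_of /passages_at => /allP;
  move: (passages w) => s cl.
rewrite filter_cat /unzip1 /unzip2 !filter_map; congr (_ ++ map _ _).
by apply: eq_in_filter => p /cl/eqP /= ->.
Qed.

Lemma euler_halfedges_at x w : euler_circuit_at x w ->
  perm_eq [seq h <- halfedges_of w | inc h == x] (enum [set h | inc h == x]).
Proof.
move=> ew; apply: uniq_perm;
  rewrite ?enum_uniq ?filter_uniq ?uniq_halfedges_of ?(euler_uniq ew) //.
move=> h; rewrite mem_filter mem_enum inE (euler_mem_halfedge _ ew).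
by case: eqP => //= ->; rewrite connect0.
Qed.

(** Each passage uses up two of the four half-edges at [x]. *)
Lemma size_passages_at x w : euler_circuit_at x w -> size (passages_at x w) = 2.
Proof.
move=> ew; have := perm_size (euler_halfedges_at ew).
rewrite -cardE reg (halfedges_at _ (euler_closed ew)) size_cat !size_map.
by case: (size _) => [|[|[|n]]] //; rewrite !addnS !addSn.
Qed.

Lemma passages_at_out x y w : euler_circuit_at x w -> ~~ linked x y ->
  passages_at y w = [::].
Proof.
move=> ew; apply: contraNeq;
  rewrite /passages_at -has_filter => /hasP[p pw /eqP <-].
by rewrite -(euler_mem_halfedge _ ew) mem_cat map_f.
Qed.

Variable C : euler_system U.

(** The default [[::]] is never returned: exactly one circuit of [C] is an Euler circuit of the
    component of [x]. *)
Definition circuit_at x : seq (dart U) :=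
  nth [::] C (find (euler_circuit_at x) C).

Lemma circuit_at_has x : has (euler_circuit_at x) C.
Proof. by rewrite has_count (eqP (forallP (circuits_count C) x)). Qed.

Lemma circuit_atP x : euler_circuit_at x (circuit_at x).
Proof. exact: nth_find (circuit_at_has x). Qed.

Lemma circuit_at_mem x : circuit_at x \in (C : seq _).
Proof. by rewrite mem_nth // -has_find circuit_at_has. Qed.

Lemma circuit_at_unique x w : w \in (C : seq _) -> euler_circuit_at x w ->
  w = circuit_at x.
Proof.
move=> wC ew; have := eqP (forallP (circuits_count C) x);
  have cx := circuit_atP x.
move: (circuit_at_mem x) wC; rewrite -size_filter => h1 h2 h3.
have : circuit_at x \in [seq u <- C | euler_circuit_at x u] by rewrite
  mem_filter cx.
have : w \in [seq u <- C | euler_circuit_at x u] by rewrite mem_filter ew.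
by case: [seq _ <- _ | _] h3 => [|a [|]] //= _; rewrite !inE => /eqP -> /eqP ->.
Qed.

Lemma circuit_connect x y : linked x y -> circuit_at x = circuit_at y.
Proof.
move=> xy; apply: circuit_at_unique (circuit_at_mem x) _.
by rewrite -(euler_connect _ xy) circuit_atP.
Qed.

Lemma circuit_at_dart w d b : w \in (C : seq _) -> d \in w ->
  w = circuit_at (inc (ends d.1 b)).
Proof.
move=> wC dw; have /existsP[x ex] := allP (circuitsP C) w wC.
rewrite (circuit_at_unique wC ex); apply: circuit_connect.
by rewrite -(euler_mem_edge _ _ ex) map_f.
Qed.

Lemma uniq_circuit_at x : uniq (circuit_at x).
Proof. exact: map_uniq (euler_uniq (circuit_atP x)). Qed.

(** A dart lies only on the circuit of its own component, so the search through all circuits reduces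
    to one. *)
Lemma consecutiveP x d d' : inc (arrive d) = x ->
  consecutive C d d' = ((d, d') \in turns (circuit_at x)).
Proof.
move=> dx; rewrite mem_turns ?uniq_circuit_at //.
apply/hasP/idP => [[w wC /andP[dw nw]] | h]; last by exists (circuit_at x);
  rewrite ?circuit_at_mem.
by rewrite -dx -(circuit_at_dart d.2 wC dw) dw nw.
Qed.

Lemma followingE x B : (B \in following C x) =
  has (fun p => B == [set p.1; p.2]) (passages_at x (circuit_at x)).
Proof.
rewrite /passages_at; apply/imsetP/hasP => [[[d d'] ] | [p]].
  rewrite !inE /= => /andP[cd /eqP dx] ->; exists (arrive d, leave d') => //.
  rewrite mem_filter dx eqxx; apply/mapP; exists (d, d') => //.
  by rewrite -consecutiveP.
rewrite mem_filter => /andP[px /mapP[[d d'] dd pE]] /eqP ->;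
  rewrite pE /= in px *.
by exists (d, d'); rewrite // !inE px (consecutiveP _ (eqP px)) dd.
Qed.

Lemma mem_incoming h : (h \in incoming C) =
  (h \in unzip1 (passages_at (inc h) (circuit_at (inc h)))).
Proof.
have -> : (h \in unzip1 (passages_at (inc h) (circuit_at (inc h)))) =
   (h \in unzip1 (passages (circuit_at (inc h)))).
  apply/mapP/mapP => -[p]; first by rewrite mem_filter => /andP[_ ?] e;
    exists p.
  by move=> pw e; exists p; rewrite // mem_filter pw -e eqxx.
rewrite unzip1_passages; apply/imsetP/mapP => -[d dw e]; last first.
  by exists d => //; apply/flattenP; exists (circuit_at (inc h));
    rewrite ?circuit_at_mem.
by move: dw => /flattenP[w wC dw]; exists d;
  rewrite // e -(circuit_at_dart d.2 wC dw).
Qed.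

Lemma mem_outgoing h : (h \in outgoing C) =
  (h \in unzip2 (passages_at (inc h) (circuit_at (inc h)))).
Proof.
have -> : (h \in unzip2 (passages_at (inc h) (circuit_at (inc h)))) =
   (h \in unzip2 (passages (circuit_at (inc h)))).
  apply/mapP/mapP => -[p]; first by rewrite mem_filter => /andP[_ ?] e;
    exists p.
  move=> pw e; exists p;
    rewrite // mem_filter pw (euler_inc (circuit_atP _) pw).
  by rewrite -e eqxx.
rewrite unzip2_passages mem_rot; apply/imsetP/mapP => -[d dw e]; last first.
  by exists d => //; apply/flattenP; exists (circuit_at (inc h));
    rewrite ?circuit_at_mem.
by move: dw => /flattenP[w wC dw]; exists d;
  rewrite // e -(circuit_at_dart (~~ d.2) wC dw).
Qed.

(* The two passages at [x] of the circuit through [x], in either order. *)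
Definition crosses x (p q : halfedge U * halfedge U) : Prop :=
  perm_eq (passages_at x (circuit_at x)) [:: p; q].

Lemma crosses_ex x : exists p q, crosses x p q.
Proof.
have := size_passages_at (circuit_atP x); rewrite /crosses.
by case: (passages_at _ _) => [|p [|q []]] // _; exists p, q.
Qed.

Section Crosses.
Variables (x : vertex U) (p q : halfedge U * halfedge U).
Hypothesis pq : crosses x p q.

Lemma crosses_perm : perm_eq [:: p.1; q.1; p.2;
  q.2] (enum [set h | inc h == x]).
Proof.
rewrite -(permPr (euler_halfedges_at (circuit_atP x))).
rewrite (halfedges_at _ (euler_closed (circuit_atP x))) perm_sym.
exact: perm_cat (perm_map fst pq) (perm_map snd pq).
Qed.

Lemma crosses_uniq : uniq [:: p.1; q.1; p.2; q.2].
Proof. by rewrite (perm_uniq crosses_perm) enum_uniq. Qed.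

Lemma crosses_mem h : (h \in [:: p.1; q.1; p.2; q.2]) = (inc h == x).
Proof. by rewrite (perm_mem crosses_perm) mem_enum inE. Qed.

Lemma crosses_following : following C x = pairing p.1 p.2 q.1 q.2.
Proof.
by apply/setP => B; rewrite followingE (perm_has _ pq) /= orbF !inE.
Qed.

Lemma crosses_incoming h : inc h = x -> (h \in incoming C) = (h \in [:: p.1;
  q.1]).
Proof. by move=> hx; rewrite mem_incoming hx (perm_mem (perm_map _ pq)). Qed.

Lemma crosses_outgoing h : inc h = x -> (h \in outgoing C) = (h \in [:: p.2;
  q.2]).
Proof. by move=> hx; rewrite mem_outgoing hx (perm_mem (perm_map _ pq)). Qed.

End Crosses.

End Circuits.

(** * Alternation after reversing a segment *)

Section WordReversal.
Variable T : eqType.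
Implicit Types (v x y : T) (s t : seq T).

Lemma alternate_skip v x y s t : v != x -> v != y ->
  alternate x y (s ++ v :: t ++ [:: v]) = alternate x y (s ++ t).
Proof.
move=> vx vy; rewrite /alternate -[v :: t ++ _]/([:: v] ++ (t ++ [:: v]))
  !trace_cat.
by rewrite {2 4}/trace /= (negPf vx) (negPf vy) /= cats0.
Qed.

Lemma alternate_reverse_center v x s t : v != x -> v \notin s -> v \notin t ->
  count_mem x (s ++ t) = 2 ->
  alternate v x (s ++ v :: rev t ++ [:: v]) =
  alternate v x (s ++ v :: t ++ [:: v]).
Proof.
move=> vx vs vt c; rewrite !alternate_split ?mem_rev //.
by rewrite count_cat count_rev -count_cat.
Qed.

(** Deleting the letters [v] leaves [s] and the reversed [t]. Alternation is toggled if [x] and [y]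
    both occur once in [s], that is, if both alternate with [v]. *)
Lemma alternate_reverse v x y s t : v != x -> v != y -> x != y ->
  v \notin s -> v \notin t ->
  count_mem x (s ++ t) = 2 -> count_mem y (s ++ t) = 2 ->
  alternate x y (s ++ v :: rev t ++ [:: v]) =
  alternate x y (s ++ v :: t ++ [:: v]) (+)
    (alternate v x (s ++ v :: t ++ [:: v]) &&
     alternate v y (s ++ v :: t ++ [:: v])).
Proof.
move=> vx vy xy vs vt cx cy.
by rewrite !(@alternate_split _ v) // !alternate_skip // alternate_cat_rev.
Qed.

End WordReversal.

Lemma card_pairI (T : finType) (a b : T) (S : {set T}) : a != b ->
  #|[set a; b] :&: S| = (a \in S) + (b \in S).
Proof.
move=> ab; rewrite (cardsD1 a) (cardsD1 b) !inE eqxx (eq_sym b) ab eqxx orbT /=.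
rewrite (_ : _ :\ b = set0) ?cards0 ?addn0 //.
by apply/setP => c; rewrite !inE; case: (c == a); case: (c == b).
Qed.

(** * Types of transitions *)

Section Types.
Variables (U : multigraph) (reg : four_regular U).
Local Notation linked := (connect (joined (U := U))).
Implicit Types (x y v : vertex U) (w : seq (dart U)) (C : euler_system U).
Implicit Types P : {set {set halfedge U}}.

(** Under 4-regularity, four distinct half-edges at [x] are all of them, so this is a partition of
    the half-edges into two pairs. *)
Definition transition x P : Prop := exists a b c d,
  [/\ uniq [:: a; b; c; d], all (fun h => inc h == x) [:: a; b; c; d]
    & P = pairing a b c d].

Lemma consistent_pairing C a b c d :
  orientation_consistent C (pairing a b c d) =
  all (fun B : {set halfedge U} =>
      (#|B :&: incoming C| == 1%N) && (#|B :&: outgoing C| == 1%N))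
    [:: [set a; b]; [set c; d]].
Proof.
apply/'forall_implyP/allP => H B; first by move=> BP; apply: H;
  rewrite !inE in BP *.
by move=> BP; apply: H; rewrite !inE in BP *.
Qed.

Section Crosses.
Variables (C : euler_system U) (x : vertex U) (p q : halfedge U * halfedge U).
Hypothesis pq : crosses C x p q.

Lemma crosses_neq : [/\ p.1 != p.2, p.1 != q.1, p.1 != q.2,
  p.2 != q.1 & p.2 != q.2 /\ q.1 != q.2].
Proof.
have := crosses_uniq pq; rewrite /= !inE !negb_or andbT.
by case/and3P => /and3P[-> -> ->] /andP[]; rewrite eq_sym => -> -> ->.
Qed.

Lemma crosses_inc : [/\ inc p.1 = x, inc p.2 = x, inc q.1 = x & inc q.2 = x].
Proof. by split; apply/eqP; rewrite -(crosses_mem pq) !inE eqxx ?orbT. Qed.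

Lemma type_follow : type_of_transition C x (pairing p.1 p.2 q.1 q.2) = TransF.
Proof. by rewrite /type_of_transition (crosses_following pq) eqxx. Qed.

(** The half-edges [p.1] and [q.1] come in, [p.2] and [q.2] go out; each block pairs an incoming one
    with the outgoing one of the other passage. *)
Lemma type_cross : type_of_transition C x (pairing p.1 q.2 p.2 q.1) = TransN.
Proof.
have [n1 n2 n3 n4 [n5 n6]] := crosses_neq; have [i1 i2 i3 i4] := crosses_inc.
rewrite /type_of_transition (crosses_following pq) (negPf (pairing_neq _ _ _
  _)); last first.
- by rewrite !inE negb_or n2 n3.
- by rewrite !inE negb_or ![q.2 == _]eq_sym n3 n5.
rewrite consistent_pairing /= !card_pairI //.
rewrite !(crosses_incoming pq) // !(crosses_outgoing pq) // !inE !eqxx.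
have sym (h h' : halfedge U) : h != h' ->
  (h == h') = false /\ (h' == h) = false.
  by rewrite (eq_sym h') => /negPf.
have [-> ->] := sym _ _ n1; have [-> ->] := sym _ _ n2;
  have [-> ->] := sym _ _ n3.
by have [-> ->] := sym _ _ n4; have [-> ->] := sym _ _ n5;
  have [-> ->] := sym _ _ n6.
Qed.

(** The first block consists of the two incoming half-edges. *)
Lemma type_inconsistent : type_of_transition C x (pairing p.1 q.1 p.2 q.2) =
  TransI.
Proof.
have [n1 n2 n3 n4 [n5 n6]] := crosses_neq; have [i1 i2 i3 i4] := crosses_inc.
rewrite /type_of_transition (crosses_following pq) (negPf (pairing_neq _ _ _
  _)); last first.
- by rewrite !inE negb_or n2 n3.
- by rewrite !inE negb_or ![q.1 == _]eq_sym n2 n4.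
by rewrite consistent_pairing /= !card_pairI // !(crosses_incoming pq) // !inE
  !eqxx orbT.
Qed.

Lemma transition_cases P : transition x P ->
  [\/ P = pairing p.1 p.2 q.1 q.2, P = pairing p.1 q.2 p.2 q.1
    | P = pairing p.1 q.1 p.2 q.2].
Proof.
move=> [a [b [c [d [u /allP inx ->]]]]]; apply: pairing_trichotomy => // h /inx.
by rewrite -(crosses_mem pq) !inE; case: (h == p.1); case: (h == q.1);
  case: (h == p.2).
Qed.

Lemma transition_following : transition x (following C x).
Proof.
have [i1 i2 i3 i4] := crosses_inc.
have [n1 n2 n3 n4 [n5 n6]] := crosses_neq.
exists p.1, p.2, q.1, q.2;
  rewrite (crosses_following pq) /= i1 i2 i3 i4 !eqxx; split=> //.
by rewrite !inE !negb_or n1 n2 n3 n4 n5 n6.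
Qed.

End Crosses.

(** The three transitions at [x] realize the three types once each. *)
Lemma type_inj C x P Q : transition x P -> transition x Q ->
  type_of_transition C x P = type_of_transition C x Q -> P = Q.
Proof.
move=> tP tQ; have [p [q pq]] := crosses_ex reg C x.
by case: (transition_cases pq tP) => ->;
  case: (transition_cases pq tQ) => -> //;
rewrite ?(type_follow pq) ?(type_cross pq) ?(type_inconsistent pq).
Qed.

Lemma type_crosses C C' x p q P : crosses C x p q -> crosses C' x p q ->
  transition x P -> type_of_transition C' x P = type_of_transition C x P.
Proof.
move=> pq pq' tP.
by case: (transition_cases pq tP) => ->;
rewrite ?(type_follow pq) ?(type_cross pq) ?(type_inconsistent pq)
  ?(type_follow pq') ?(type_cross pq') ?(type_inconsistent pq').
Qed.

(** Turning both passages around exchanges incoming and outgoing half-edges, which affects neither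
    the blocks nor consistency. *)
Lemma type_crosses_swap C C' x p q P : crosses C x p q ->
  crosses C' x (swap p) (swap q) ->
  transition x P -> type_of_transition C' x P = type_of_transition C x P.
Proof.
move=> pq pq' tP.
case: (transition_cases pq tP) => ->.
- by rewrite (type_follow pq) pairing_swapl pairing_swapr (type_follow pq').
- by rewrite (type_cross pq) pairingC (type_cross pq').
by rewrite (type_inconsistent pq) pairingC (type_inconsistent pq').
Qed.

Definition swapFI t := match t with TransF => TransI | TransI =>
  TransF | TransN => TransN end.

Definition swapNI t := match t with TransN => TransI | TransI =>
  TransN | TransF => TransF end.

(** Turning one passage around keeps the followed blocks but makes [q.2] incoming and [q.1]
    outgoing, so consistency of the other two transitions is exchanged. *)
Lemma type_crosses_half C C' x p q P : crosses C x p q ->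
  crosses C' x p (swap q) ->
  transition x P -> type_of_transition C' x P = swapNI (type_of_transition C x
    P).
Proof.
move=> pq pq' tP.
case: (transition_cases pq tP) => ->.
- by rewrite (type_follow pq) pairing_swapr (type_follow pq').
- by rewrite (type_cross pq) (type_inconsistent pq').
by rewrite (type_inconsistent pq) (type_cross pq').
Qed.

(** The circuit now follows the formerly inconsistent transition. The formerly followed one pairs
    [p.1] with [p.2], now both incoming. *)
Lemma type_crosses_center C C' x p q P :
  crosses C x p q -> crosses C' x (p.1, q.1) (p.2, q.2) ->
  transition x P -> type_of_transition C' x P = swapFI (type_of_transition C x
    P).
Proof.
move=> pq pq' tP.
case: (transition_cases pq tP) => ->.
- by rewrite (type_follow pq) (type_inconsistent pq').
- by rewrite (type_cross pq) pairing_swapr (type_cross pq').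
by rewrite (type_inconsistent pq) (type_follow pq').
Qed.

Definition word (s : seq (halfedge U * halfedge U)) : seq (vertex U) :=
  [seq inc p.1 | p <- s].

(** The first passage takes place at the end of the first dart, hence the rotation by one. *)
Lemma word_passages w : closed_walk w ->
  word (passages w) = rot 1 [seq inc (leave d) | d <- w].
Proof.
rewrite closed_walkE => /allP cl.
rewrite (map_comp _ (@leave U)) -map_rot -unzip2_passages /unzip2 -map_comp.
by apply/eq_in_map => p /cl/eqP.
Qed.

Lemma count_word x s : count_mem x (word s) = size [seq p <- s | inc p.1 == x].
Proof. by rewrite /word count_map size_filter. Qed.

Lemma count_word_passages C x y : linked x y ->
  count_mem y (word (passages (circuit_at C x))) = 2.
Proof.
move=> xy; rewrite count_word -/(passages_at y _) (circuit_connect C xy).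
exact: (size_passages_at reg (circuit_atP C y)).
Qed.

Lemma count_word_out C x y : ~~ linked x y ->
  count_mem y (word (passages (circuit_at C x))) = 0.
Proof.
by move=> xy; rewrite count_word -/(passages_at y _) (passages_at_out
  (circuit_atP C x) xy).
Qed.

Lemma count_word_le C x y : count_mem y (word (passages (circuit_at C x))) <= 2.
Proof.
case xy: (linked x y); first by rewrite count_word_passages.
by rewrite count_word_out ?xy.
Qed.

Lemma cyclic_patternE C z x y : x != y ->
  cyclic_pattern (circuit_at C z) x y = alternate x y (word (passages
    (circuit_at C z))).
Proof.
move=> xy; have := word_passages (euler_closed (circuit_atP C z)).
have := count_word_le C z y; have := count_word_le C z x.
rewrite /cyclic_pattern; move: (circuit_at C z) => w + + e; rewrite e.
set s := [seq _ | _ <- w] => cx cy.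
have cs i j u : count_mem u (rot i s) = count_mem u (rot j s).
  by apply/permP; rewrite perm_rot perm_sym perm_rot.
apply/existsP/idP => [[n sub] | ].
  rewrite alternate_rot -(alternate_rot _ _ n) /alternate.
  by rewrite (trace_subseq xy _ _ sub) // (cs _ 1).
rewrite alternate_rot => /alternate_subseq[] sub; first by exists ord0;
  rewrite rot0.
(* The other reading starts with [y]; the cyclic pattern is symmetric. *)
apply/existsP; apply: cyclic_pattern_sym; apply/existsP.
by exists ord0; rewrite rot0.
Qed.

Lemma interlacedE C x y : interlaced C x y =
  (x != y) && alternate x y (word (passages (circuit_at C x))).
Proof.
rewrite /interlaced; have [//|xy] /= := eqVneq x y.
apply/hasP/idP => [[w wC pat] | ]; last first.
  by rewrite -cyclic_patternE // => h; exists (circuit_at C x);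
    rewrite ?circuit_at_mem.
rewrite -cyclic_patternE // -(_ : w = circuit_at C x) //.
(* A circuit with the pattern passes through [x], hence is the circuit at [x]. *)
case/existsP: pat => n /mem_subseq/(_ x);
  rewrite !inE eqxx mem_rot => /(_ isT)/mapP[d dw ->].
exact: (circuit_at_dart _ wC dw).
Qed.

Lemma interlaced_connect C x y : interlaced C x y -> linked x y.
Proof.
rewrite interlacedE => /andP[xy]; apply: contraTT => /(count_word_out C) c.
have nt : count negb (trace x y (word (passages (circuit_at C x)))) = 0.
  by rewrite count_negb_trace.
rewrite /alternate; apply/negP; rewrite /alternating !inE => /orP[] /eqP e;
by rewrite e in nt.
Qed.

End Types.

(** * Switching at a vertex *)

Section Switching.
Variables (U : multigraph) (reg : four_regular U).
Local Notation linked := (connect (joined (U := U))).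
Implicit Types (x y v : vertex U) (w : seq (dart U)) (C : euler_system U).

Lemma euler_circuit_perm x w w' : closed_walk w -> closed_walk w' ->
  perm_eq [seq d.1 | d <- w] [seq d.1 | d <- w'] ->
  euler_circuit_at x w' = euler_circuit_at x w.
Proof.
move=> cw cw' ww'; rewrite /euler_circuit_at cw cw' (perm_uniq ww').
by congr (_ && (_ && _)); apply: eq_forallb => e; rewrite (perm_mem ww').
Qed.

(** The hypothesis makes [w] an Euler circuit of the same component as the circuit at [v], so
    trading one for the other preserves all counts. *)
Lemma replace_circuit C v w :
  (forall x, euler_circuit_at x w = euler_circuit_at x (circuit_at C v)) ->
  exists C', forall x, circuit_at C' x =
    if linked v x then w else circuit_at C x.
Proof.
move=> ew; pose S := w :: rem (circuit_at C v) C.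
have permC : perm_eq C (circuit_at C v :: rem (circuit_at C v) C).
  exact: perm_to_rem (circuit_at_mem C v).
have SP : all (fun u => [exists x, euler_circuit_at x u]) S.
  have := circuitsP C; rewrite (perm_all _ permC) /= =>
    /andP[/existsP[x ex] ->].
  by rewrite andbT; apply/existsP; exists x; rewrite ew.
have Sc : [forall x, count (euler_circuit_at x) S == 1%N].
  apply/forallP => x; have := forallP (circuits_count C) x.
  by move/permP: permC => ->; rewrite /= ew.
exists (EulerSystem SP Sc) => x; case: ifP => vx; apply/esym/circuit_at_unique.
- exact: mem_head.
- by rewrite ew -(euler_connect _ vx) circuit_atP.
(* The circuit at [x] is not the replaced one: it passes through [x], which lies in another
   component than [v]. *)
- rewrite inE; have := circuit_at_mem C x; rewrite (perm_mem permC) inE.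
  case/orP => [/eqP e|->]; last exact: orbT.
  have := size_passages_at reg (circuit_atP C x).
  by rewrite e (passages_at_out (circuit_atP C v)) ?vx.
exact: circuit_atP.
Qed.

(** The passages inside the open walk [d :: w], without the one that would close it. *)
Definition steps d w : seq (halfedge U * halfedge U) :=
  [seq (arrive p.1, leave p.2) | p <- links d w].

Lemma passages_cat a b (A B : seq (dart U)) :
  passages (a :: A ++ b :: B) =
  steps a A ++ (arrive (last a A), leave b) :: steps b B
    ++ [:: (arrive (last b B), leave a)].
Proof.
rewrite /passages turns_cons links_cat last_cat /= map_rcons map_cat /=.
by rewrite -cats1 -catA.
Qed.

Lemma steps_reverse b (B : seq (dart U)) :
  steps (flip (last b B)) [seq flip d | d <- rev (belast b B)] =
  rev [seq swap p | p <- steps b B].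
Proof.
rewrite /steps links_map links_rev !map_rev -!map_comp; congr rev.
by apply: eq_map => p; rewrite /= arrive_flip leave_flip.
Qed.

Lemma reverse_cons b (B : seq (dart U)) :
  reverse (b :: B) = flip (last b B) :: [seq flip d | d <- rev (belast b B)].
Proof. by rewrite /reverse -map_rev lastI rev_rcons. Qed.

(** Only the two junctions are paired anew, arrival with arrival and departure with departure; the
    passages inside [b :: B] are turned around. *)
Lemma passages_cat_reverse a b (A B : seq (dart U)) :
  passages (a :: A ++ reverse (b :: B)) =
  steps a A ++ (arrive (last a A), arrive (last b B))
    :: rev [seq swap p | p <- steps b B] ++ [:: (leave b, leave a)].
Proof.
rewrite reverse_cons passages_cat steps_reverse leave_flip.
suff -> : last (flip (last b B)) [seq flip d | d <- rev (belast b B)] = flip b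
  by [].
by case: (B) => //= c B'; rewrite last_map rev_cons last_rcons.
Qed.

Lemma circuit_split C v : exists k a A b B,
  [/\ rot k (circuit_at C v) = a :: A ++ b :: B,
    inc (leave a) = v & inc (leave b) = v].
Proof.
(* A circuit leaves [v] as often as it passes through it, namely twice; it is cut at these two
   departures. *)
have cnt k : count (fun d => inc (leave d) == v) (rot k (circuit_at C v)) = 2.
  rewrite (seq.permP (permEl (perm_rot k _))) -(count_word_passages reg C
    (connect0 _ v)).
  rewrite word_passages ?(euler_closed (circuit_atP C v)) //.
  by rewrite (seq.permP (permEl (perm_rot 1 _))) count_map.
have /hasP[a aC av] : has (fun d => inc (leave d) == v) (circuit_at C v).
  by rewrite has_count -(rot0 (circuit_at C v)) cnt.
have [k s ks] := rot_to aC; move: (cnt k); rewrite ks /= av add1n => -[c1].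
have /hasP[b bs bv] : has (fun d => inc (leave d) == v) s.
  by rewrite has_count c1.
case/splitPr: bs ks {c1} => A B ks.
by exists k, a, A, b, B; rewrite (eqP av) (eqP bv).
Qed.

(* The effect of the kappa-transformation at [v] on interlacement and on the types
   of transitions; a relation because circuits carry a starting point and a
   direction, which are immaterial. *)
Definition switched C v C' : Prop :=
  (forall x y, interlaced C' x y =
     interlaced C x y (+) [&& x != y, interlaced C v x & interlaced C v y]) /\
  (forall x P, transition x P -> type_of_transition C' x P =
     if x == v then swapFI (type_of_transition C x P)
     else if interlaced C v x then swapNI (type_of_transition C x P)
     else type_of_transition C x P).

Section Switch.
Variables (C C' : euler_system U) (v : vertex U).
Variables (k : nat) (a b : dart U) (A B : seq (dart U)).
Hypothesis Ck : rot k (circuit_at C v) = a :: A ++ b :: B.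
Hypothesis av : inc (leave a) = v.
Hypothesis bv : inc (leave b) = v.

(** In cyclic order the circuit consists of [PA], [p], [PB], [q], where [p] and [q] are its passages
    at [v]. *)
Let PA := steps a A.
Let PB := steps b B.
Let p := (arrive (last a A), leave b).
Let q := (arrive (last b B), leave a).

Let perm_passages :
  perm_eq (passages (circuit_at C v)) (PA ++ p :: PB ++ [:: q]).
Proof. by rewrite -passages_cat -Ck passages_rot perm_sym perm_rot. Qed.

Let incE r : r \in PA ++ p :: PB ++ [:: q] -> inc r.1 = inc r.2.
Proof. by rewrite -(perm_mem perm_passages);
  apply: euler_inc (circuit_atP C v). Qed.

Let pv : inc p.1 = v.
Proof. by rewrite incE ?bv // mem_cat mem_head orbT. Qed.

Let qv : inc q.1 = v.
Proof. by rewrite incE ?av // !(mem_cat, inE) eqxx !orbT. Qed.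

(** [p] and [q] already account for both passages at [v]. *)
Let PAv : [seq r <- PA | inc r.1 == v] = [::].
Proof.
have := size_passages_at reg (circuit_atP C v).
rewrite (perm_size (perm_filter _ perm_passages)) !filter_cat /= !filter_cat /=
  pv qv eqxx.
by rewrite size_cat /= size_cat addn1 !addnS; case: [seq _ <- PA | _].
Qed.

Let PBv : [seq r <- PB | inc r.1 == v] = [::].
Proof.
have := size_passages_at reg (circuit_atP C v).
rewrite (perm_size (perm_filter _ perm_passages)) !filter_cat /= !filter_cat /=
  pv qv eqxx.
by rewrite size_cat /= size_cat addn1 !addnS addnC; case: [seq _ <- PB | _].
Qed.

Let wA := word PA.
Let wB := word PB.

Let alternate_before x y :
  alternate x y (word (passages (circuit_at C v))) =
  alternate x y (wA ++ v :: wB ++ [:: v]).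
Proof.
rewrite -(alternate_rot _ _ k) /word -map_rot -passages_rot Ck passages_cat.
by rewrite map_cat /= map_cat /= -/(p.1) -/(q.1) pv qv.
Qed.

Let count_before x : linked v x -> v != x -> count_mem x (wA ++ wB) = 2.
Proof.
move=> vx /negPf nvx; rewrite -(count_word_passages reg C vx) [RHS]count_word.
rewrite (perm_size (perm_filter _ perm_passages)) -count_word /word !map_cat /=
  map_cat.
by rewrite !count_cat /= count_cat /= pv qv nvx /= add0n !addn0.
Qed.

Let vA : v \notin wA.
Proof. by apply/count_memPn; rewrite count_word PAv. Qed.

Let vB : v \notin wB.
Proof. by apply/count_memPn; rewrite count_word PBv. Qed.

Lemma crosses_split : crosses C v p q.
Proof.
rewrite /crosses; apply: perm_trans (perm_filter _ perm_passages) _.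
by rewrite filter_cat /= filter_cat /= PAv PBv pv qv eqxx.
Qed.

Lemma passages_at_split x : linked v x -> v != x ->
  perm_eq (passages_at x (circuit_at C x))
    ([seq r <- PA | inc r.1 == x] ++ [seq r <- PB | inc r.1 == x]).
Proof.
move=> vx /negPf nvx; rewrite -(circuit_connect _ vx).
apply: perm_trans (perm_filter _ perm_passages) _.
by rewrite filter_cat /= filter_cat /= pv qv nvx cats0.
Qed.

(** There are two passages at [x]; an odd number of them in [PA] means one in each half. *)
Lemma interlaced_split x : linked v x -> v != x ->
  interlaced C v x = odd (size [seq r <- PA | inc r.1 == x]).
Proof.
move=> vx nvx; rewrite interlacedE // nvx /= alternate_before.
by rewrite alternate_split ?count_before ?count_word.
Qed.

Lemma switch_exists : exists C', forall x, circuit_at C' x =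
    if linked v x then a :: A ++ reverse (b :: B) else circuit_at C x.
Proof.
apply: (replace_circuit (C := C)) => x; apply: euler_circuit_perm.
- exact: euler_closed (circuit_atP C v).
(* Both new junctions are at [v], and the other passages are old ones, possibly turned around. *)
- rewrite closed_walkE passages_cat_reverse -/PA -/PB.
  rewrite all_cat /= all_cat all_rev all_map /= bv av -[arrive (last a A)]/p.1.
  rewrite -[arrive (last b B)]/q.1 pv qv eqxx !andbT.
  apply/andP; split; apply/allP => r rP /=;
    rewrite incE // !(mem_cat, inE) rP ?orbT //.
- have: perm_eq (circuit_at C v) (a :: A ++ b :: B) by rewrite -Ck perm_sym
  perm_rot.
  move/(perm_map fst)/perm_trans; apply;
    rewrite -!cat_cons !map_cat perm_cat //.
  by rewrite /reverse map_rev -map_comp perm_sym perm_rev.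
Qed.

Hypothesis C'E : forall x, circuit_at C' x =
  if linked v x then a :: A ++ reverse (b :: B) else circuit_at C x.

Let passages_after : passages (circuit_at C' v) =
  PA ++ (p.1, q.1) :: rev [seq swap r | r <- PB] ++ [:: (p.2, q.2)].
Proof. by rewrite C'E connect0 passages_cat_reverse. Qed.

Let alternate_after x y :
  alternate x y (word (passages (circuit_at C' v))) =
  alternate x y (wA ++ v :: rev wB ++ [:: v]).
Proof.
rewrite passages_after /word !map_cat /= map_cat map_rev -map_comp /= -/(p.1)
  pv bv.
(* A swapped passage is listed at [inc r.2], which equals [inc r.1]. *)
congr (alternate _ _ (_ ++ _ :: rev _ ++ _)); apply/eq_in_map => r rB /=.
by rewrite [RHS]incE // !(mem_cat, inE) rB !orbT.
Qed.

Lemma interlaced_switch x y : interlaced C' x y =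
  interlaced C x y (+) [&& x != y, interlaced C v x & interlaced C v y].
Proof.
have conn D z t : ~~ linked z t -> interlaced D z t = false.
  by apply: contraNF; apply: interlaced_connect.
have [<-|xy] /= := eqVneq x y; first by rewrite addbF /interlaced eqxx.
have [vx|nvx] := boolP (linked v x); last first.
  by rewrite (conn C v x) //= addbF !interlacedE // C'E (negPf nvx).
have [vy|nvy] := boolP (linked v y); last first.
  rewrite (conn C v y) // andbF addbF;
    apply/idP/idP => /(interlaced_connect reg)/(connect_trans vx);
  by rewrite (negPf nvy).
(* Reversal moves no passage to the other half, so interlacement with [v] is unchanged. *)
have center t : v != t -> linked v t -> interlaced C' v t = interlaced C v t.
  move=> vt cvt; rewrite !interlacedE // vt /= alternate_before alternate_after.
  by rewrite alternate_reverse_center // count_before.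
have vv D : interlaced D v v = false by rewrite /interlaced eqxx.
have [ev|nv] := eqVneq v x; first by rewrite -ev vv addbF center // ev.
have [ev|nv'] := eqVneq v y.
  by rewrite -ev vv andbF addbF ![interlaced _ x v]interlaced_sym center.
rewrite !interlacedE // xy nv nv' /= -!(circuit_connect _ vx).
rewrite !alternate_before alternate_after alternate_reverse //;
  exact: count_before.
Qed.

Lemma type_switch x P : transition x P -> type_of_transition C' x P =
  if x == v then swapFI (type_of_transition C x P)
  else if interlaced C v x then swapNI (type_of_transition C x P)
  else type_of_transition C x P.
Proof.
move=> tP; have [ev|nv] := eqVneq x v.
  rewrite ev in tP *; apply: (type_crosses_center crosses_split) => //.
  rewrite /crosses /passages_at passages_after filter_cat /= filter_cat /= PAv.
  rewrite -/(p.1) pv bv eqxx filter_rev filter_map (_ : [seq r <- PB | _] =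
    [::]) //.
  rewrite -[RHS]PBv; apply/eq_in_filter => r rB /=.
  by rewrite [inc r.1]incE // !(mem_cat, inE) rB !orbT.
(* Outside the component of [v] the circuit is the old one. *)
have [vx|nvx] := boolP (linked v x); last first.
  have -> : interlaced C v x = false by apply: contraNF nvx;
    apply: interlaced_connect.
  have [r [s rs]] := crosses_ex reg C x.
  by apply: (type_crosses rs) => //; rewrite /crosses C'E (negPf nvx).
have vxN : (v == x) = false by rewrite eq_sym (negPf nv).
have before := passages_at_split vx (negbT vxN).
have after : perm_eq (passages_at x (circuit_at C' x))
    ([seq r <- PA | inc r.1 == x] ++ [seq swap r | r <- PB & inc r.1 == x]).
  rewrite -(circuit_connect _ vx) /passages_at passages_after filter_cat /=
    filter_cat /=.
  rewrite -/(p.1) pv bv vxN cats0 filter_rev filter_map perm_cat // perm_rev.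
  rewrite (_ : [seq r <- PB | _] = [seq r <- PB | inc r.1 == x]) //.
  apply/eq_in_filter => r rB /=.
  by rewrite [inc r.1]incE // !(mem_cat, inE) rB !orbT.
rewrite (interlaced_split vx) ?vxN //.
have := size_passages_at reg (circuit_atP C x).
rewrite (perm_size before) size_cat.
(* The three cases: both passages at [x] lie in [b :: B] and are turned around, or just one does, or
   none. *)
case eA: [seq r <- PA | _] before after => [|r [|r' [|? ?]]];
  case eB: [seq r <- PB | _] => [|s [|s' [|? ?]]] //= before after _.
- exact: (type_crosses_swap before after).
- exact: (type_crosses_half before after).
- exact: (type_crosses before after).
Qed.

End Switch.

Lemma switched_exists C v : exists C', switched C v C'.
Proof.
have [k [a [A [b [B [Ck av bv]]]]]] := circuit_split C v.
have [C' C'E] := switch_exists Ck av bv.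
by exists C'; split; [apply: interlaced_switch Ck av bv C'E | apply:
  type_switch Ck av bv C'E].
Qed.

End Switching.

(** * Kotzig's theorem *)

Section Kotzig.
Variables (U : multigraph) (reg : four_regular U).
Local Notation linked := (connect (joined (U := U))).
Implicit Types (x y v : vertex U) (w : seq (dart U)) (C : euler_system U).

Lemma following_unique C x h (B B' : {set halfedge U}) :
  B \in following C x -> B' \in following C x -> h \in B -> h \in B' -> B = B'.
Proof.
have [p [q pq]] := crosses_ex reg C x; rewrite (crosses_following pq) !inE.
have [n1 n2 n3 n4 [n5 n6]] := crosses_neq pq.
case/orP => /eqP -> /orP[] /eqP -> //;
  rewrite !inE => /orP[] /eqP -> /orP[] /eqP e;
by rewrite -?e ?e eqxx in n2 n3 n4 n5.
Qed.

Lemma following_inc C x h B : B \in following C x -> h \in B -> inc h = x.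
Proof.
have [p [q pq]] := crosses_ex reg C x; have [i1 i2 i3 i4] := crosses_inc pq.
by rewrite (crosses_following pq) !inE => /orP[] /eqP ->;
  rewrite !inE => /orP[] /eqP ->.
Qed.

Lemma passages_following C x r : r \in passages (circuit_at C x) ->
  [set r.1; r.2] \in following C (inc r.1).
Proof.
move=> rC; rewrite followingE; apply/hasP; exists r => //;
  rewrite mem_filter eqxx /=.
rewrite -(circuit_connect C (x := x)) // -(euler_mem_halfedge _ (circuit_atP C
  x)).
by rewrite mem_cat map_f.
Qed.

(* Depends on [C] only through [following C], and its cycles are the circuits of
   [C] and their reverses. *)
Definition next_dart C d : dart U :=
  odflt d [pick d' | [set arrive d; leave d'] \in following C (inc (arrive d))].

Lemma next_dartE C d d' :
  [set arrive d; leave d'] \in following C (inc (arrive d)) ->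
    next_dart C d = d'.
Proof.
move=> dd'; rewrite /next_dart; case: pickP => [d2 dd2|/(_ d')];
  last by rewrite dd'.
have := following_unique dd' dd2 (set21 _ _) (set21 _ _) => e;
  apply/leave_inj/eqP.
have : leave d' \in [set arrive d; leave d2] by rewrite -e set22.
have : leave d2 \in [set arrive d; leave d'] by rewrite e set22.
rewrite !inE => /orP[/eqP -> | //] /orP[/eqP -> | /eqP -> //]; exact: eqxx.
Qed.

Lemma fcycle_circuit C x : fcycle (next_dart C) (circuit_at C x).
Proof.
rewrite cycle_turns; apply/allP => -[d d'] dd'; apply/eqP/next_dartE.
by apply: (@passages_following C x (arrive d, leave d')); apply/mapP;
  exists (d, d').
Qed.

Lemma fcycle_reverse C x : fcycle (next_dart C) (reverse (circuit_at C x)).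
Proof.
rewrite cycle_turns; apply/allP => -[d d'] dd'; apply/eqP/next_dartE => /=.
have : (arrive d, leave d') \in passages (reverse (circuit_at C x)).
  by apply/mapP; exists (d, d').
rewrite (perm_mem (passages_reverse _)) => /mapP[r rC [-> ->]].
by rewrite setUC -(euler_inc (circuit_atP C x) rC);
  apply: passages_following rC.
Qed.

Lemma mem_reverse d w : (d \in reverse w) = (flip d \in w).
Proof. by rewrite mem_rev -{1}(flipK d) (mem_map (can_inj (@flipK U))). Qed.

(** * Euler systems with the same transitions *)

Section SameTransitions.
Variables C C' : euler_system U.
Hypothesis same : forall x, following C x = following C' x.

(** Both circuits, and the reverse of the second, are orbits of the same successor function on
    darts. They share an edge; its direction in each decides whether the second circuit must be
    reversed. *)
Lemma circuit_same x : exists i j,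
  rot i (circuit_at C x) = rot j (circuit_at C' x) \/
  rot i (circuit_at C x) = rot j (reverse (circuit_at C' x)).
Proof.
have fE w : fcycle (next_dart C') w -> fcycle (next_dart C) w.
  by rewrite (@eq_fcycle _ _ (next_dart C)) // => d; rewrite /next_dart same.
have [w [d dw]] : exists w d, d \in circuit_at C x.
  have := size_passages_at reg (circuit_atP C x).
  case: (circuit_at C x) => // d w _; exists w, d; exact: mem_head.
have uw := uniq_circuit_at C x; have uw' := uniq_circuit_at C' x.
have [i ei] := orbit_rot_cycle (fcycle_circuit C x) uw dw; exists i.
have : d.1 \in [seq d.1 | d <- circuit_at C' x].
  rewrite (euler_mem_edge _ true (circuit_atP C' x)).
  by rewrite -(euler_mem_edge _ true (circuit_atP C x)) map_f.
case/mapP => d' d'w ed.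
have [e|ne] := eqVneq d d'.
  have [j ej] := orbit_rot_cycle (fE _ (fcycle_circuit C' x)) uw' d'w;
    exists j; left.
  by rewrite -ei -ej e.
have e : flip d = d'.
  case: d d' ed ne {dw d'w ei} => [e c] [e' c'] /= ->; rewrite /flip /=.
  by rewrite xpair_eqE eqxx /= negb_eqb; case: c c' => [] [].
have dr : d \in reverse (circuit_at C' x) by rewrite mem_reverse e.
have ur : uniq (reverse (circuit_at C' x)).
  by rewrite rev_uniq (map_inj_uniq (can_inj (@flipK U))).
have [j ej] := orbit_rot_cycle (fE _ (fcycle_reverse C' x)) ur dr; exists j;
  right.
by rewrite -ei -ej.
Qed.

Lemma interlaced_same x y : interlaced C x y = interlaced C' x y.
Proof.
rewrite !interlacedE //; congr andb.
have [i [j e]] := circuit_same x.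
have altr k w : alternate x y (word (passages (rot k w))) = alternate x y (word
  (passages w)).
  by rewrite passages_rot /word map_rot alternate_rot.
rewrite -(altr i); case: e => ->; rewrite altr //.
(* Since [arrive (flip d)] is [leave d], the reversed circuit has the old word read backwards, up to
   rotation. *)
rewrite [in RHS]word_passages ?(euler_closed (circuit_atP _ _)) //.
rewrite /word (map_comp (@inc U) fst) -/(unzip1 _) unzip1_passages
  alternate_rot -[RHS]alternate_rev.
by rewrite -map_rev -!map_comp /reverse -map_rev -map_comp.
Qed.

Lemma crosses_same x p q : crosses C x p q ->
  crosses C' x p q \/ crosses C' x (swap p) (swap q).
Proof.
rewrite /crosses => pq; have [i [j [e|e]]] := circuit_same x; [left | right].
  apply: perm_trans pq; apply: perm_filter.
  by rewrite -(perm_rot j) perm_sym -(perm_rot i) -!passages_rot e perm_refl.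
have : perm_eq (passages (circuit_at C x)) [seq swap r | r <- passages
  (circuit_at C' x)].
  rewrite -(perm_rot i (passages _)) -passages_rot e passages_rot perm_rot.
  exact: passages_reverse.
move=> /(perm_filter (fun r => inc r.1 == x))/(perm_map (@swap _)).
have swapK (s : seq (halfedge U * halfedge U)) : [seq swap r | r <- [seq swap r
  | r <- s]] = s.
  by rewrite -map_comp -[RHS]map_id; apply: eq_map => -[].
have -> : [seq r <- [seq swap r | r <- passages (circuit_at C' x)] | inc r.1 ==
  x] =
    [seq swap r | r <- passages_at x (circuit_at C' x)].
  have := @euler_inc _ _ _ ^~ (circuit_atP C' x); rewrite /passages_at.
  move: (passages _) => s es; rewrite filter_map; congr map.
  by apply: eq_in_filter => r /es /= ->.
by rewrite swapK perm_sym => /perm_trans; apply; apply: perm_map pq.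
Qed.

Lemma type_same x P : transition x P ->
  type_of_transition C x P = type_of_transition C' x P.
Proof.
move=> tP; have [p [q pq]] := crosses_ex reg C x; apply/esym.
by case: (crosses_same pq) => pq';
  [apply: type_crosses pq pq' tP | apply: type_crosses_swap pq pq' tP].
Qed.

End SameTransitions.

Lemma cross_neighbor C C' v :
  type_of_transition C v (following C' v) = TransN ->
  (forall x, type_of_transition C x (following C' x) <> TransI) ->
  exists x, interlaced C v x /\ type_of_transition C x (following C' x) =
    TransN.
Proof.
move=> vN noI; apply: contrapT => none.
(* Under the negated conclusion all neighbours of [v] have type F, as I is excluded; this will
   contradict that [C'] has one circuit through [v]. *)
have F x : interlaced C v x -> type_of_transition C x (following C' x) = TransF.
  move=> vx; have := noI x; case e: (type_of_transition _ _ _) => // _.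
  by case: none; exists x.
have tC' x : transition x (following C' x).
  by have [p [q pq]] := crosses_ex reg C' x; apply: transition_following pq.
have [k [a [A [b [B [Ck av bv]]]]]] := circuit_split reg C v.
pose EA := [seq d.1 | d <- a :: A].
pose inA h := h \in halfedges_of (a :: A).
have arrA d : inA (arrive d) = (d.1 \in EA) by rewrite /inA mem_halfedges_of.
have leaA d : inA (leave d) = (d.1 \in EA) by rewrite /inA mem_halfedges_of.
have uE : uniq [seq d.1 | d <- (a :: A) ++ b :: B].
  by rewrite cat_cons -Ck map_rot rot_uniq (euler_uniq (circuit_atP C v)).
have inEA d : d \in a :: A -> d.1 \in EA by apply: map_f.
have outEA d : d \in b :: B -> d.1 \notin EA.
  move=> dB; move: uE; rewrite map_cat cat_uniq => /and3P[_ /hasPn H _].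
  exact/H/map_f.
have linksP c (D : seq (dart U)) r : r \in steps c D ->
    exists d d', [/\ d \in c :: D, d' \in c :: D & r = (arrive d, leave d')].
  case/mapP => -[d d'] dd' ->; exists d, d'; split=> //.
    have : d \in unzip1 (links c D) by exact: map_f dd'.
    by rewrite unzip1_zip ?size_belast //; apply: mem_belast.
  have : d' \in unzip2 (links c D) by exact: map_f dd'.
  by rewrite unzip2_zip ?size_belast // inE orbC => ->.
have pair_A (i o j l h h' : halfedge U) : inA i = inA o -> inA j = inA l ->
    [set h; h'] \in pairing i o j l -> inA h = inA h'.
  move=> io jl; rewrite !inE => /orP[] /eqP e.
    have : h \in [set i; o] by rewrite -e set21.
    have : h' \in [set i; o] by rewrite -e set22.
    by rewrite !inE => /orP[] /eqP -> /orP[] /eqP ->.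
  have : h \in [set j; l] by rewrite -e set21.
  have : h' \in [set j; l] by rewrite -e set22.
  by rewrite !inE => /orP[] /eqP -> /orP[] /eqP ->.
have inPA r : r \in steps a A -> inA r.1 /\ inA r.2.
  by case/linksP => d [d' [dA dA' ->]]; rewrite arrA leaA !inEA.
have inPB r : r \in steps b B -> inA r.1 = false /\ inA r.2 = false.
  by case/linksP => d [d' [/outEA/negPf dB /outEA/negPf dB' ->]];
    rewrite arrA leaA.
(* At [v] the transition of [C'] joins the two ends of the walk [a :: A], at a
   vertex interlaced with [v] it is a passage of [C], and the two passages through
   any other vertex both lie in [a :: A] or both in [b :: B]. *)
have closedA x (h h' : halfedge U) : [set h;
  h'] \in following C' x -> inA h -> inA h'.
  move=> hh' hA; have hx := following_inc hh' (set21 _ _).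
  have vx : linked v x.
    rewrite -hx -(euler_mem_halfedge _ (circuit_atP C v)); move: hA;
      rewrite /inA.
    have [e [c ->]] := endsP h; rewrite !mem_halfedges_of => eA.
    by rewrite -(mem_rot k) -map_rot Ck -cat_cons map_cat mem_cat eA.
  rewrite -(_ : inA h = inA h') //.
  have [exv|nxv] := eqVneq v x.
    rewrite -exv in hh'; have pq := crosses_split reg Ck av bv.
    have := transition_cases pq (tC' v); case=> e; rewrite e in hh' vN.
    - by rewrite (type_follow pq) in vN.
    - apply: pair_A hh'; rewrite !arrA !leaA.
        by rewrite !inEA ?mem_head ?mem_last.
      by rewrite !(negPf (outEA _ _)) ?mem_head ?mem_last.
    by rewrite (type_inconsistent pq) in vN.
  have perm_x := passages_at_split Ck av bv vx nxv.
  have [r [s rs]] := crosses_ex reg C x.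
  have mem_rs t : t \in [:: r; s] -> t \in steps a A ++ steps b B.
    rewrite -(perm_mem rs) (perm_mem perm_x) !mem_cat !mem_filter.
    by case/orP => /andP[_ ->]; rewrite ?orbT.
  have same t : t \in [:: r; s] -> inA t.1 = inA t.2.
    by move/mem_rs; rewrite mem_cat => /orP[/inPA | /inPB] [-> ->].
  have rx : following C' x = pairing r.1 r.2 s.1 s.2 \/
      [/\ following C' x = pairing r.1 s.2 r.2 s.1 & ~~ interlaced C v x].
    case: (transition_cases rs (tC' x)) => e; [by left | right; split=> // | ].
      by apply/negP => /F; rewrite e (type_cross rs).
    by case: (noI x); rewrite e (type_inconsistent rs).
  case: rx => [e | [e]]; rewrite e in hh'.
    by apply: pair_A hh'; apply: same; rewrite !inE eqxx ?orbT.
  rewrite (interlaced_split reg Ck av bv vx nxv) => even.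
  suff rs_A : inA r.1 = inA s.1.
    by apply: pair_A hh'; rewrite -!same ?rs_A // !inE eqxx ?orbT.
  have : perm_eq [:: r; s]
      ([seq r <- steps a A | inc r.1 == x] ++ [seq r <- steps b B | inc r.1 ==
        x]).
    by rewrite -(permPl rs).
  move=> ms; have := perm_size ms; rewrite size_cat.
  case eA : [seq _ <- steps a A | _] even ms => [|r1 [|r2 [|? ?]]] //= _ ms.
    have inB t : t \in [:: r; s] -> inA t.1 = false.
      by rewrite (perm_mem ms) mem_filter => /andP[_ /inPB[]].
    by rewrite !inB // !inE eqxx ?orbT.
  case: [seq _ <- steps b B | _] ms => // ms _.
  have inA' t : t \in [:: r; s] -> inA t.1.
    by rewrite (perm_mem ms) -eA mem_filter => /andP[_ /inPA[]].
  by rewrite !inA' // !inE eqxx ?orbT.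
(* Implication is transitive, so from consecutive darts of the cycle it extends to any two of its
   darts. *)
have all_A : all2rel (fun d d' : dart U =>
  (d.1 \in EA) ==> (d'.1 \in EA)) (circuit_at C' v).
  rewrite -cycle_all2rel; last first.
    by move=> d2 d1 d3; case: (d1.1 \in EA) => //=; case: (d2.1 \in EA).
  rewrite cycle_turns; apply/allP => -[d d'] dd' /=; apply/implyP.
  rewrite -arrA -leaA; apply: closedA.
  by apply: (@passages_following C' v (arrive d, leave d')); apply/mapP;
    exists (d, d').
have inC' (d : dart U) c : inc (ends d.1 c) = v ->
  exists2 d' : dart U, d' \in circuit_at C' v & d'.1 = d.1.
  move=> dv; have : d.1 \in [seq d.1 | d <- circuit_at C' v].
    by rewrite (euler_mem_edge _ c (circuit_atP C' v)) dv connect0.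
  by case/mapP => d' ? ?; exists d'.
(* The edges of [a] and [b] both end at [v], so the circuit of [C'] traverses both, yet only the
   first is in [EA]. *)
have [a' a'C ea] := inC' a (~~ a.2) av; have [b' b'C eb] := inC' b (~~ b.2) bv.
have := allrelP all_A _ _ a'C b'C; rewrite ea eb inEA ?mem_head //=.
by rewrite (negPf (outEA _ (mem_head _ _))).
Qed.

(** [Q] abstracts reachability: it can be any property preserved by switching. The induction is on
    the number of vertices where the transitions disagree. *)
Lemma kotzig (Q : euler_system U -> Prop) C C' :
  (forall C1 v C2, switched C1 v C2 -> Q C1 -> Q C2) -> Q C ->
  exists2 C2, Q C2 & forall x, following C2 x = following C' x.
Proof.
move=> Qs QC; pose ty D x := type_of_transition D x (following C' x).
pose bad D := [set x | if ty D x is TransF then false else true].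
have tC' x : transition x (following C' x).
  by have [p [q pq]] := crosses_ex reg C' x; apply: transition_following pq.
have [n] := ubnP #|bad C|; elim: n C QC => // n IH C QC /ltnSE lenC.
have step C1 v C2 : switched C1 v C2 -> forall x, ty C2 x =
    if x == v then swapFI (ty C1 x) else if interlaced C1 v x then swapNI (ty
      C1 x) else ty C1 x.
  by move=> [_ H] x; apply: H.
(* Enough for the induction: one disagreement is repaired and no agreement is lost. *)
have decr C2 v : Q C2 -> ty C v <> TransF -> ty C2 v = TransF ->
    (forall x, ty C x = TransF -> ty C2 x = TransF) ->
    exists2 C2, Q C2 & forall x, following C2 x = following C' x.
  move=> Q2 vC vC2 keep; apply: (IH C2 Q2); apply: leq_trans lenC;
    apply: proper_card.
  apply/properP; split; last by exists v; rewrite !inE ?vC2 //;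
    case: (ty C v) vC.
  apply/fintype.subsetP => x; rewrite !inE; case e: (ty C x) => //.
  by rewrite keep.
have [[v vI]|noI] := pselect (exists v, ty C v = TransI).
  have [C1 s1] := switched_exists reg C v.
  apply: (decr C1 v (Qs _ _ _ s1 QC));
    rewrite ?vI // ?(step _ _ _ s1) ?eqxx ?vI //.
  (* Type F changes only at the center of a switch. *)
  move=> x xF; rewrite (step _ _ _ s1) xF; case: eqP => [e|_];
    last by case: ifP.
  by rewrite -e xF in vI.
have noI' x : ty C x <> TransI.
  by move=> xI; apply: noI; exists x.
have [[v vN]|noN] := pselect (exists v, ty C v = TransN).
  have [w [vw wN]] := cross_neighbor vN noI'.
  have [C1 s1] := switched_exists reg C v.
  have [C2 s2] := switched_exists reg C1 w.
  have [C3 s3] := switched_exists reg C2 v.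
  have nvw : v != w by apply: contraTneq vw => ->; rewrite /interlaced eqxx.
  have irr D z : interlaced D z z = false by rewrite /interlaced eqxx.
  (* A switch toggles no pair containing its center, so [v] and [w] stay interlaced. *)
  have vw1 : interlaced C1 w v by rewrite (proj1 s1) irr !andbF addbF
    interlaced_sym.
  have vw2 : interlaced C2 v w by rewrite (proj1 s2) irr !andbF addbF
    interlaced_sym.
  apply: (decr C3 v (Qs _ _ _ s3 (Qs _ _ _ s2 (Qs _ _ _ s1 QC)))).
  - by rewrite [ty C v]vN.
  (* At [v] the type goes from N to N as center, to I as neighbour of [w], and to F as center
     again. *)
  - rewrite (step _ _ _ s3) eqxx (step _ _ _ s2) (negPf nvw) vw1 (step _ _ _
    s1) eqxx.
    by rewrite [ty C v]vN.
  move=> x xF.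
  have [ex|nxv] := eqVneq x v; first by rewrite ex [ty C v]vN in xF.
  have [ex|nxw] := eqVneq x w; first by rewrite ex [ty C w]wN in xF.
  rewrite (step _ _ _ s3) (negPf nxv) (step _ _ _ s2) (negPf nxw) (step _ _ _
    s1) (negPf nxv) xF.
  by do 3 case: ifP.
(* Neither I nor N occurs any more, so the transitions agree everywhere. *)
exists C => // x; have [p [q pq]] := crosses_ex reg C x.
apply: (@type_inj _ reg C _ _ _ (transition_following pq) (tC' x)).
rewrite (crosses_following pq) (type_follow pq).
case e: (ty C x) => //; last by case: noI; exists x.
by case: noN; exists x.
Qed.

End Kotzig.

(** * Marked interlacement graphs *)

(** The proof fields are equalities between booleans, of which there is at most one proof. *)
Lemma MarkedGraph_eq (V : finType) (adj adj' : {ffun V -> {ffun V -> bool}})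
    (looped : {ffun V -> bool}) (m m' : {ffun V -> mark}) n s s' i i' :
  adj = adj' -> m = m' ->
  @MarkedGraph V adj looped m n s i = @MarkedGraph V adj' looped m' n s' i'.
Proof. by move=> ea em; subst; congr MarkedGraph; apply: bool_irrelevance. Qed.

Lemma imset_bool (S : finType) (f : bool ->
  S) : [set f b | b : bool] = [set f true; f false].
Proof.
apply/setP => B; rewrite !inE; apply/imsetP/orP => [[[] _ ->]|[]/eqP->];
  rewrite ?eqxx; auto.
  by exists true.
by exists false.
Qed.

Section Universe.
Variables (R : realType) (D : link_diagram R).
Implicit Types (C : euler_system (universe D)) (x v : vertex (universe D)).

(** Coordinates of the half-edges at [x]: [p.1] tells the overpass from the underpass, [p.2] leaving
    from entering. *)
Definition halfedge_at x (p : bool * bool) : halfedge (universe D) :=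
  (x, p.1, p.2).

Lemma halfedge_at_inj x : injective (halfedge_at x).
Proof. by move=> [b c] [b' c'] [-> ->]. Qed.

Lemma universe_regular : four_regular (universe D).
Proof.
move=> x; rewrite (_ : [set h | _] = [set halfedge_at x p | p : bool * bool]).
  by rewrite (card_imset _ (@halfedge_at_inj x)) card_prod card_bool.
apply/setP => h; rewrite inE; apply/eqP/imsetP => [<- | [p _ ->] //].
by exists (h.1.2, h.2); case: h => [[]].
Qed.

Lemma transition_halfedge_at x p q r s : uniq [:: p; q; r; s] ->
  transition x (pairing (halfedge_at x p) (halfedge_at x q) (halfedge_at x r)
    (halfedge_at x s)).
Proof.
move=> u; exists (halfedge_at x p), (halfedge_at x q), (halfedge_at x r),
  (halfedge_at x s).
split=> //; last by rewrite /= !eqxx.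
by rewrite -[[:: _; _; _; _]]/(map (halfedge_at x) [:: p; q; r;
  s]) (map_inj_uniq (@halfedge_at_inj x)).
Qed.

Lemma oriented_smoothingE x : oriented_smoothing x =
  pairing (halfedge_at x (true, false)) (halfedge_at x (false, true))
          (halfedge_at x (false, false)) (halfedge_at x (true, true)).
Proof. exact: imset_bool. Qed.

Lemma unoriented_smoothingE x : unoriented_smoothing x =
  pairing (halfedge_at x (true, true)) (halfedge_at x (false, true))
          (halfedge_at x (true, false)) (halfedge_at x (false, false)).
Proof. exact: imset_bool. Qed.

Lemma oriented_transition x : transition x (oriented_smoothing x).
Proof. by rewrite oriented_smoothingE; apply: transition_halfedge_at. Qed.

Lemma unoriented_transition x : transition x (unoriented_smoothing x).
Proof. by rewrite unoriented_smoothingE; apply: transition_halfedge_at. Qed.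

Lemma smoothings_neq x : oriented_smoothing x <> unoriented_smoothing x.
Proof.
rewrite oriented_smoothingE unoriented_smoothingE pairing_swapl.
rewrite [in X in _ <> X]pairing_swapl; apply/eqP.
by apply: pairing_neq; rewrite !inE !(inj_eq (@halfedge_at_inj x)).
Qed.

Lemma marked_interlacement_graph_same C C' : (forall x,
  following C x = following C' x) ->
  marked_interlacement_graph C = marked_interlacement_graph C'.
Proof.
move=> same; have reg := universe_regular; apply: MarkedGraph_eq;
  apply/ffunP => x; rewrite !ffunE.
  by apply/ffunP => y; rewrite !ffunE; apply: interlaced_same.
by rewrite !(type_same reg same) //;
  [apply: unoriented_transition | apply: oriented_transition].
Qed.

(** Loops and free loops depend on the diagram alone, so only adjacency and marks need
    comparison. *)
Lemma marked_interlacement_graph_switched C v C' : switched C v C' ->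
  marked_interlacement_graph C' = @mlc (marked_interlacement_graph C) v.
Proof.
move=> [sI sT]; have reg := universe_regular; apply: MarkedGraph_eq;
  apply/ffunP => x; rewrite !ffunE.
  by apply/ffunP => y; rewrite !ffunE sI.
(* This rules out the pairs of equal types, which fall into the default case of [mark_of_types]. *)
have tneq : type_of_transition C x (oriented_smoothing x) <>
    type_of_transition C x (unoriented_smoothing x).
  move=> /(type_inj reg (oriented_transition x) (unoriented_transition x)).
  exact: smoothings_neq.
rewrite !sT; [ | exact: unoriented_transition | exact: oriented_transition].
rewrite /=; case: ifP => _; last case: ifP => _ //.
(* The six pairs of distinct types are the six marks; exchanging F and I is the change at the
   center, exchanging N and I the change at a neighbour. *)
all: by case: (type_of_transition C x (oriented_smoothing x)) tneq;
  case: (type_of_transition C x (unoriented_smoothing x)).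
Qed.

End Universe.

Theorem theorem7 (R : realType) (D : link_diagram R)
    (C : euler_system (universe D)) (G' : marked_graph) :
  (exists C' : euler_system (universe D),
    G' = marked_interlacement_graph C') <->
  mlc_reachable (marked_interlacement_graph C) G'.
Proof.
have reg := @universe_regular R D.
split=> [[C' ->] | ]; last first.
  (* Each local complementation is realized by a switch at the same vertex. *)
  elim=> [|H v _ [C' HC']]; first by exists C.
  subst H; have [C2 s2] := switched_exists reg C' v.
  by exists C2; rewrite (marked_interlacement_graph_switched s2).
(* Kotzig's theorem is applied to the property of having a reachable interlacement graph. *)
have [||C2 reach same] := @kotzig _ reg
  (fun C2 => mlc_reachable (marked_interlacement_graph C)
    (marked_interlacement_graph C2)) C C'.
- move=> C1 v C2 s2; rewrite (marked_interlacement_graph_switched s2).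
  exact: mlc_step.
- exact: mlc_refl.
by rewrite -(marked_interlacement_graph_same same).
Qed.
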